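(* For any tetrahedron $T$ in $\mathbb{R}^3$, $$1\leq\frac{\mathrm{Diam}(T)}{\mathrm{diam}(T)}\leq\frac{2}{\sqrt{3}},$$ and both inequalities are sharp. The first inequality becomes an equality, for example, for $\varepsilon$-thick tetrahedra with $\varepsilon$ small enough (that is, there is $\varepsilon_0>0$ such that $\mathrm{Diam}(T)=\mathrm{diam}(T)$ for every $\varepsilon$-thick tetrahedron $T$ with $0<\varepsilon<\varepsilon_0$), while the second inequality becomes an equality for the regular tetrahedron.
   Context: A tetrahedron is identified with its surface, a convex polyhedral surface in $\mathbb{R}^3$. For a convex surface $S\subset\mathbb{R}^3$, the intrinsic metric $\rho(x,y)$ is the length of a shortest path on $S$ joining $x,y\in S$. The intrinsic diameter is $\mathrm{Diam}(S)=\max_{x,y\in S}\rho(x,y)$ and the extrinsic diameter is $\mathrm{diam}(S)=\max_{x,y\in S}\|x-y\|$, with $\|\cdot\|$ the Euclidean norm. For $\varepsilon>0$, an $\varepsilon$-thick tetrahedron is a tetrahedron $T$ with one edge included in a ball of radius $\varepsilon\,\mathrm{diam}(T)$ centered at the midpoint of its longest edge. *)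

(* Defs.v *)
From HB Require Import structures.
From mathcomp Require Import all_boot all_order all_algebra.
From mathcomp Require Import all_classical all_reals all_analysis.

Set Implicit Arguments.
Unset Strict Implicit.
Unset Printing Implicit Defensive.

Import Order.TTheory GRing.Theory Num.Theory.
Import numFieldNormedType.Exports.

Local Open Scope classical_set_scope.
Local Open Scope ring_scope.

Section IntrinsicMetric.
Variable R : realType.
Implicit Types (S : set 'rV[R]_3) (g : R -> 'rV[R]_3).

(* The library's norm on matrices is the sup norm; it induces the same
   topology, so library continuity can be used for curves below, but it
   cannot be used to measure lengths. *)
Definition enorm (x : 'rV[R]_3) : R := Num.sqrt (\sum_i x 0 i ^+ 2).

(* Same as the library's [variation] and [total_variation] (on [0, 1]), with
   the Euclidean norm in place of the absolute value on R. *)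
Definition inscribed_length g (s : seq R) : R :=
  let G := g \o nth 1 (0 :: s) in
  \sum_(0 <= n < size s) enorm (G n.+1 - G n).

Definition curve_length g : \bar R :=
  ereal_sup [set (inscribed_length g s)%:E | s in itv_partition 0 1].

Definition is_path_on S (x y : 'rV[R]_3) g : Prop :=
  [/\ {within `[0, 1], continuous g}, g 0 = x, g 1 = y
    & g @` `[0, 1] `<=` S].

(* Extended-real valued: +oo if no path on S joins x to y, or if all of them
   are nonrectifiable. *)
Definition intrinsic_dist S (x y : 'rV[R]_3) : \bar R :=
  ereal_inf [set curve_length g | g in is_path_on S x y].

Definition intrinsic_diam S : \bar R :=
  ereal_sup [set intrinsic_dist S p.1 p.2 | p in S `*` S].

Definition extrinsic_diam S : \bar R :=
  ereal_sup [set (enorm (p.1 - p.2))%:E | p in S `*` S].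

(* Division in \bar R: if the denominator is finite and positive, this is a
   real number only if the numerator is one. *)
Definition diam_ratio S : \bar R :=
  (intrinsic_diam S / extrinsic_diam S)%E.

Definition eclosed_ball (c : 'rV[R]_3) (r : \bar R) : set 'rV[R]_3 :=
  [set x | ((enorm (x - c))%:E <= r)%E].

End IntrinsicMetric.

(* The row_free condition is affine independence of the four vertices. *)
Record tetrahedron (R : realType) := Tetrahedron {
  vertex : 'I_4 -> 'rV[R]_3 ;
  vertex_row_free : row_free (\matrix_(i < 3) (vertex (lift ord0 i) - vertex ord0)) }.

Section Tetrahedra.
Variable R : realType.
Implicit Type T : tetrahedron R.

(* The face opposite to vertex k, in barycentric coordinates. *)
Definition face T (k : 'I_4) : set 'rV[R]_3 :=
  [set x | exists w : 'I_4 -> R,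
    [/\ forall i, 0 <= w i, \sum_i w i = 1, w k = 0
      & x = \sum_i w i *: vertex T i]].

Definition surface T : set 'rV[R]_3 := \bigcup_(k in [set: 'I_4]) face T k.

(* The next three concern edges of T only for i != j. *)
Definition edge T (i j : 'I_4) : set 'rV[R]_3 :=
  [set (1 - t) *: vertex T i + t *: vertex T j | t in `[0, 1]].

Definition edge_length T (i j : 'I_4) : R := enorm (vertex T i - vertex T j).

Definition edge_midpoint T (i j : 'I_4) : 'rV[R]_3 :=
  2^-1 *: (vertex T i + vertex T j).

Definition longest_edge T (i j : 'I_4) : Prop :=
  i != j /\ forall k l, k != l -> edge_length T k l <= edge_length T i j.

Definition thick (eps : R) T : Prop :=
  exists i j k l, [/\ longest_edge T i j, k != l
    & edge T k l `<=` eclosed_ball (edge_midpoint T i j)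
                        (eps%:E * extrinsic_diam (surface T))%E].

Definition regular T : Prop :=
  forall i j k l, i != j -> k != l -> edge_length T i j = edge_length T k l.

End Tetrahedra.

(* Main.v *)
Require Import Defs.
From mathcomp Require Import all_boot all_order all_algebra.
From mathcomp Require Import all_classical all_reals all_analysis.
From mathcomp Require Import ring lra.

Set Implicit Arguments.
Unset Strict Implicit.
Unset Printing Implicit Defensive.

Import Order.TTheory GRing.Theory Num.Theory.
Import numFieldNormedType.Exports.

Local Open Scope classical_set_scope.
Local Open Scope ring_scope.

(** Upper bound. Let x lie on ABC and y on ABD. The pairs (x, y) joined by a
    path of length at most k through AB, through BC and BD, or through AC and
    AD, form three convex sets. If (x, y) avoids all three, separate it from
    each; in a domain of dimension at least 3 some direction does not decrease
    any of the three separating functionals, so (x, y) can be moved to the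
    boundary while still avoiding the sets. This reduces everything to x and y
    on two edges, where an explicit path of length at most the diameter d
    exists, or to a vertex and a point y of the opposite face. In the latter
    case y sees some edge of that face under an angle of at least 120 degrees,
    and the path through the foot of the bisector of this angle has length at
    most 2 d / sqrt 3. For thick tetrahedra explicit paths from a vertex to the
    opposite face have length at most d, hence so do all distances.

    Lower bound for the regular tetrahedron. On the surface there is a function
    that is 1-Lipschitz on each face and differs by 2 d / sqrt 3 between a
    vertex and the centre of the opposite face; a path decomposes into finitely
    many pieces whose ends lie on a common face. *)

(** * Euclidean geometry and separation *)

Section Euclid.
Variable R : realType.
Implicit Types u v w : 'rV[R]_3.

Definition dot u v : R := \sum_i u 0 i * v 0 i.

Lemma dotC u v : dot u v = dot v u.
Proof. by apply: eq_bigr => i _; rewrite mulrC. Qed.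

Lemma dotDl u v w : dot (u + v) w = dot u w + dot v w.
Proof. by rewrite -big_split; apply: eq_bigr => i _; rewrite mxE mulrDl. Qed.

Lemma dotZl (a : R) u w : dot (a *: u) w = a * dot u w.
Proof. by rewrite mulr_sumr; apply: eq_bigr => i _; rewrite mxE mulrA. Qed.

Lemma dotNl u w : dot (- u) w = - dot u w.
Proof. by rewrite -scaleN1r dotZl mulN1r. Qed.

Lemma dotDr u v w : dot w (u + v) = dot w u + dot w v.
Proof. by rewrite dotC dotDl !(dotC w). Qed.

Lemma dotZr (a : R) u w : dot w (a *: u) = a * dot w u.
Proof. by rewrite dotC dotZl (dotC w). Qed.

Lemma dotNr u w : dot w (- u) = - dot w u.
Proof. by rewrite dotC dotNl (dotC w). Qed.

Definition dotE := (dotDl, dotDr, dotNl, dotNr, dotZl, dotZr).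

Lemma dot0l u : dot 0 u = 0.
Proof. by rewrite -(scale0r u) dotZl mul0r. Qed.

Lemma enorm_sqr u : enorm u ^+ 2 = dot u u.
Proof.
have -> : dot u u = \sum_i u 0 i ^+ 2 by apply: eq_bigr => i _; rewrite expr2.
by rewrite sqr_sqrtr // sumr_ge0 // => i _; rewrite sqr_ge0.
Qed.

Lemma enorm_ge0 u : 0 <= enorm u. Proof. exact: sqrtr_ge0. Qed.

Lemma enorm_leP u (a : R) : 0 <= a -> (enorm u <= a) = (dot u u <= a ^+ 2).
Proof. by move=> a0; rewrite -enorm_sqr ler_sqr ?nnegrE // enorm_ge0. Qed.

Lemma enorm_eq0 u : enorm u = 0 -> u = 0.
Proof.
move=> u0; have /psumr_eq0P du : dot u u = 0 by rewrite -enorm_sqr u0 expr0n.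
apply/rowP => i; rewrite mxE; apply/eqP; rewrite -sqrf_eq0 expr2; apply/eqP.
by apply: du => // j _; rewrite -expr2 sqr_ge0.
Qed.

Lemma enorm0 : enorm (0 : 'rV[R]_3) = 0.
Proof. by apply/eqP; rewrite -sqrf_eq0 enorm_sqr dot0l. Qed.

Lemma enormZ (a : R) u : enorm (a *: u) = `|a| * enorm u.
Proof.
apply/eqP; rewrite -(eqrXn2 (n := 2)) ?mulr_ge0 ?enorm_ge0 //.
by rewrite exprMn !enorm_sqr dotZl dotZr mulrA -expr2 -(real_normK (num_real a)).
Qed.

Lemma enormN u : enorm (- u) = enorm u.
Proof. by rewrite -scaleN1r enormZ normrN1 mul1r. Qed.

Lemma enorm_distC u v : enorm (u - v) = enorm (v - u).
Proof. by rewrite -enormN opprB. Qed.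

(** Lagrange's identity: the product of the squared norms exceeds the squared dot product by the
    three squared 2 by 2 minors. *)
Lemma CauchySchwarz u v : dot u v <= enorm u * enorm v.
Proof.
apply: le_trans (ler_norm _) _.
rewrite -ler_sqr ?nnegrE ?mulr_ge0 ?enorm_ge0 //.
rewrite exprMn !enorm_sqr real_normK ?num_real //.
rewrite /dot !big_ord_recl !big_ord0 !addr0.
set a := u _ _; set b := u _ _; set c := u _ _.
set a' := v _ _; set b' := v _ _; set c' := v _ _.
have -> : (a * a + (b * b + c * c)) * (a' * a' + (b' * b' + c' * c')) =
  (a * a' + (b * b' + c * c')) ^+ 2 + (a * b' - b * a') ^+ 2
   + (a * c' - c * a') ^+ 2 + (b * c' - c * b') ^+ 2 by ring.
by rewrite -!addrA lerDl !addr_ge0 ?sqr_ge0.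
Qed.

Lemma ler_enormD u v : enorm (u + v) <= enorm u + enorm v.
Proof.
rewrite enorm_leP ?addr_ge0 ?enorm_ge0 // !dotE (dotC v u) sqrrD !enorm_sqr.
by have := CauchySchwarz u v; rewrite mulr2n; lra.
Qed.

Lemma ler_enorm_dist w u v : enorm (u - v) <= enorm (u - w) + enorm (w - v).
Proof. by rewrite -[u - v](subrKA w); exact: ler_enormD. Qed.

Lemma ler_coord_enorm u i : `|u 0 i| <= enorm u.
Proof.
rewrite -ler_sqr ?nnegrE ?enorm_ge0 // enorm_sqr real_normK ?num_real //.
rewrite /dot (bigD1 i) //= -expr2 lerDl.
by apply: sumr_ge0 => j _; rewrite -expr2 sqr_ge0.
Qed.

Definition convex_pred (K : 'rV[R]_3 -> Prop) :=
  forall u v t, K u -> K v -> 0 <= t -> t <= 1 -> K ((1 - t) *: u + t *: v).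

(* The separating normal points to z from an almost nearest point of K. *)
Lemma separation (K : 'rV[R]_3 -> Prop) z (delta M : R) :
    convex_pred K -> 0 < delta ->
    (forall u, K u -> delta <= enorm (u - z)) ->
    (forall u, K u -> enorm (u - z) <= M) ->
  exists g, forall u, K u -> dot g (u - z) < 0.
Proof.
move=> Kconv delta0 Kdelta KM.
have [[u1 Ku1]|Kno] := pselect (exists u, K u); last first.
  by exists 0 => u Ku; case: Kno; exists u.
pose D := [set dot (u - z) (u - z) | u in K].
have D0 : D !=set0 by exists (dot (u1 - z) (u1 - z)); exists u1.
have Dlb : lbound D (delta ^+ 2).
  move=> _ [u Ku <-].
  by rewrite -enorm_sqr ler_sqr ?nnegrE ?enorm_ge0 ?Kdelta // ltW.
pose m := inf D.
have m0 : 0 < m.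
  by apply: lt_le_trans (lb_le_inf D0 Dlb); rewrite exprn_gt0.
have mlb u : K u -> m <= dot (u - z) (u - z).
  by move=> Ku; apply: ge_inf; [exists (delta ^+ 2) | exists u].
have madh e : 0 < e -> exists2 u, K u & dot (u - z) (u - z) < m + e.
  move=> e0; have [|_ [u Ku <-] ?] := @inf_adherent _ D e e0; last by exists u.
  by split=> //; exists (delta ^+ 2).
clearbody m.
have mM : m <= M ^+ 2.
  apply: le_trans (mlb _ Ku1) _; rewrite -enorm_sqr ler_sqr ?nnegrE ?enorm_ge0 //.
    exact: KM.
  exact: le_trans (enorm_ge0 _) (KM _ Ku1).
have M0 : 0 < M ^+ 2 by exact: lt_le_trans mM.
have M4 : 0 < 4 * M ^+ 2 by rewrite mulr_gt0.
(* Since [u - u0] will have norm at most 2M, this [t] bounds the quadratic term of |w - z|^2 by t m.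
   The squared distance of [u0] exceeds the infimum by less than t m / 2, so the dot product of
   [u0 - z] and [u - u0] is above -3m/4, while |u0 - z|^2 >= m. *)
pose t := m / (4 * M ^+ 2).
have t0 : 0 < t by rewrite divr_gt0.
have tM : t * (4 * M ^+ 2) = m by rewrite /t mulfVK // gt_eqF.
have t1 : t <= 1 by rewrite ler_pdivrMr //; lra.
clearbody t.
have [|u0 Ku0 u0m] := madh (t * m / 2); first by rewrite divr_gt0 // mulr_gt0.
exists (z - u0) => u Ku.
pose w := (1 - t) *: u0 + t *: u.
have Kw : K w by apply: Kconv => //; exact: ltW.
have uu0 : dot (u - u0) (u - u0) <= 4 * M ^+ 2.
  have -> : 4 * M ^+ 2 = (M + M) ^+ 2 by ring.
  have M0' : 0 <= M by exact: le_trans (enorm_ge0 _) (KM _ Ku1).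
  rewrite -enorm_leP ?addr_ge0 //.
  apply: le_trans (ler_enorm_dist z _ _) _.
  by rewrite lerD ?KM // enorm_distC KM.
have := mlb _ Kw.
have -> : w - z = (u0 - z) + t *: (u - u0).
  by apply/rowP => i; rewrite !mxE; ring.
have -> : u - z = (u0 - z) + (u - u0).
  by apply/rowP => i; rewrite !mxE; ring.
rewrite -(opprB u0 z).
set a := u0 - z in u0m *; set b := u - u0 in uu0 *.
have := mlb _ Ku0; rewrite -/a => aa.
clearbody a b; rewrite !dotE (dotC b a) => H.
have tb : t * (t * dot b b) <= t * m.
  by rewrite ler_pM2l // -tM ler_pM2l.
rewrite -(pmulr_llt0 _ t0); nra.
Qed.

(** Dependent normals have a common orthogonal vector; for independent ones [dot (g i) v = 1] can be
    solved for all [i] at once. *)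
Lemma nonneg_direction (g : 'I_3 -> 'rV[R]_3) :
  exists v, v != 0 /\ forall i, 0 <= dot (g i) v.
Proof.
pose M := (\matrix_i g i)^T.
have dotM v i : dot (g i) v = (v *m M) 0 i.
  by rewrite mxE; apply: eq_bigr => j _; rewrite !mxE mulrC.
have [/det0P[v v0 vM]|detM] := boolP (\det M == 0).
  by exists v; split=> // i; rewrite dotM vM mxE.
have uM : M \in unitmx by rewrite unitmxE unitfE.
exists (const_mx 1 *m invmx M); split; last first.
  by move=> i; rewrite dotM mulmxKV // mxE ler01.
apply/eqP => v0.
have /rowP/(_ 0) : const_mx 1 *m invmx M *m M = 0 :> 'rV[R]_3 by rewrite v0 mul0mx.
by rewrite mulmxKV // !mxE => /eqP; rewrite oner_eq0.
Qed.

(* [l.1 + t * l.2] are the values of affine constraints along a ray. *)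
Lemma first_exit (s : seq (R * R)) :
    (forall l, l \in s -> 0 <= l.1) -> (exists2 l, l \in s & l.2 < 0) ->
  exists t, [/\ 0 <= t, forall l, l \in s -> 0 <= l.1 + t * l.2 &
                exists2 l, l \in s & l.1 + t * l.2 = 0].
Proof.
elim: s => [|[a m] s IHs] s0 [l ls lneg]; first by rewrite in_nil in ls.
have a0 : 0 <= a by apply: (s0 (a, m)); rewrite mem_head.
have s0' l' : l' \in s -> 0 <= l'.1.
  by move=> l's; apply: s0; rewrite in_cons l's orbT.
(* If the head constraint is used up by time [t], its zero [a / - m] is an exit time: it does not
   exceed [t], and affine functions nonnegative at 0 and at [t] are so in between. *)
have exit_m t : m < 0 -> (forall l', l' \in s -> 0 <= l'.1 + t * l'.2) ->
    a + t * m <= 0 -> exists t, [/\ 0 <= t,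
      forall l', l' \in (a, m) :: s -> 0 <= l'.1 + t * l'.2 &
      exists2 l', l' \in (a, m) :: s & l'.1 + t * l'.2 = 0].
  move=> m0 ts tm.
  have em : a / - m * m = - a by rewrite invrN mulrN mulNr mulfVK // lt_eqF.
  have e0 : 0 <= a / - m by rewrite divr_ge0 // oppr_ge0 ltW.
  exists (a / - m); split=> //; last by exists (a, m); rewrite ?mem_head //= em subrr.
  move=> l'; rewrite in_cons => /orP[/eqP-> /=|l's]; first by rewrite em subrr.
  have et : a / - m <= t by rewrite ler_pdivrMr ?oppr_gt0 //; lra.
  have := ts _ l's; have := s0' _ l's.
  case: (leP 0 l'.2) => l'2 l'1 l't; first by rewrite addr_ge0 // mulr_ge0.
  by apply: le_trans l't _; rewrite lerD2l ler_nM2r.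
have [sneg|sneg] := pselect (exists2 l', l' \in s & l'.2 < 0).
  have [t [t0 ts [l' l's l't]]] := IHs s0' sneg.
  case: (leP 0 (a + t * m)) => atm.
    exists t; split=> //; last by exists l' => //; rewrite in_cons l's orbT.
    by move=> l''; rewrite in_cons => /orP[/eqP->|/ts].
  by apply: (exit_m t); [nra | exact: ts | exact: ltW].
have m0 : m < 0.
  move: ls; rewrite in_cons => /orP[/eqP le|ls]; first by rewrite le in lneg.
  by case: sneg; exists l.
(* No constraint in [s] decreases, so only the zero of the head matters. *)
apply: (exit_m (a / - m)) => // [l' l's|].
  have l'2 : 0 <= l'.2.
    by rewrite leNgt; apply/negP => l'2; apply: sneg; exists l'.
  by rewrite addr_ge0 ?s0' // mulr_ge0 // divr_ge0 // oppr_ge0 ltW.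
by rewrite invrN mulrN mulNr mulfVK ?subrr // lt_eqF.
Qed.

End Euclid.

(** * Convex families of routes *)

Ltac rowring := apply/rowP => ?; rewrite !mxE; ring.

Section Routes.
Variable R : realType.
Implicit Types (x y z p q A B C D P Q X Y : 'rV[R]_3) (k d t : R).

Definition seg P Q z := exists t : R, [/\ 0 <= t, t <= 1 & z = (1 - t) *: P + t *: Q].

Definition tri A B C z := exists a b c : R,
  [/\ 0 <= a, 0 <= b, 0 <= c, a + b + c = 1 & z = a *: A + b *: B + c *: C].

Lemma seg_sym P Q z : seg P Q z -> seg Q P z.
Proof.
move=> [t [t0 t1 ->]]; exists (1 - t); split; [lra | lra |].
by rewrite opprB addrCA subrr addr0 addrC.
Qed.

Lemma seg_l P Q : seg P Q P.
Proof. by exists 0; split=> //; rewrite subr0 scale1r scale0r addr0. Qed.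

Lemma seg_r P Q : seg P Q Q.
Proof. exact/seg_sym/seg_l. Qed.

Lemma seg_conv P Q z z' t : seg P Q z -> seg P Q z' -> 0 <= t -> t <= 1 ->
  seg P Q ((1 - t) *: z + t *: z').
Proof.
move=> [a [a0 a1 ->]] [b [b0 b1 ->]] t0 t1; exists ((1 - t) * a + t * b).
by split; [nra | nra | rowring].
Qed.

Lemma tri_rot A B C z : tri A B C z -> tri B C A z.
Proof.
move=> [a [b [c [a0 b0 c0 s ->]]]]; exists b, c, a; split=> //; first lra.
by rewrite -addrA addrC.
Qed.

Lemma tri_swap A B C z : tri A B C z -> tri B A C z.
Proof.
move=> [a [b [c [a0 b0 c0 s ->]]]]; exists b, a, c; split=> //; first lra.
by rewrite (addrC (a *: A)).
Qed.

Lemma seg_tri A B C z : seg A B z -> tri A B C z.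
Proof.
move=> [t [t0 t1 ->]]; exists (1 - t), t, 0; split=> //; [lra | lra |].
by rewrite scale0r addr0.
Qed.

Lemma tri_conv A B C z z' t : tri A B C z -> tri A B C z' -> 0 <= t -> t <= 1 ->
  tri A B C ((1 - t) *: z + t *: z').
Proof.
move=> [a [b [c [a0 b0 c0 s ->]]]] [a' [b' [c' [a'0 b'0 c'0 s' ->]]]] t0 t1.
exists ((1 - t) * a + t * a'), ((1 - t) * b + t * b'), ((1 - t) * c + t * c').
split; [nra | nra | nra | | rowring].
have -> : (1 - t) * a + t * a' + ((1 - t) * b + t * b') +
  ((1 - t) * c + t * c') = (1 - t) * (a + b + c) + t * (a' + b' + c') by ring.
by rewrite s s'; ring.
Qed.

Lemma tri_dist A B C x y d : tri A B C x -> enorm (A - y) <= d ->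
  enorm (B - y) <= d -> enorm (C - y) <= d -> enorm (x - y) <= d.
Proof.
move=> [a [b [c [a0 b0 c0 s ->]]]] Ay By Cy.
have -> : a *: A + b *: B + c *: C - y =
    a *: (A - y) + b *: (B - y) + c *: (C - y).
  by rewrite -[y in LHS]scale1r -s; rowring.
have -> : d = a * d + b * d + c * d by rewrite -!mulrDl s mul1r.
have le_term e Z : 0 <= e -> enorm Z <= d -> enorm (e *: Z) <= e * d.
  by move=> e0 Zd; rewrite enormZ ger0_norm // ler_wpM2l.
apply: le_trans (ler_enormD _ _) _; apply: lerD; last exact: le_term.
by apply: le_trans (ler_enormD _ _) _; apply: lerD; exact: le_term.
Qed.

Lemma tri_dist2 A B C x y d : 0 <= d -> tri A B C x -> tri A B C y ->
  enorm (A - B) <= d -> enorm (B - C) <= d -> enorm (A - C) <= d ->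
  enorm (x - y) <= d.
Proof.
move=> d0 hx hy AB BC AC.
by apply: (tri_dist hx);
  rewrite enorm_distC; apply: (tri_dist hy);
  rewrite ?subrr ?enorm0 // enorm_distC.
Qed.

Lemma ler_enorm_conv x y x' y' t : 0 <= t -> t <= 1 ->
  enorm (((1 - t) *: x + t *: x') - ((1 - t) *: y + t *: y')) <=
  (1 - t) * enorm (x - y) + t * enorm (x' - y').
Proof.
move=> t0 t1; have -> : (1 - t) *: x + t *: x' - ((1 - t) *: y + t *: y') =
  (1 - t) *: (x - y) + t *: (x' - y') by rowring.
apply: le_trans (ler_enormD _ _) _.
by rewrite !enormZ !ger0_norm ?subr_ge0.
Qed.

Definition route P0 P1 Q0 Q1 k x y := exists p q,
  [/\ seg P0 P1 p, seg Q0 Q1 q & enorm (x - p) + enorm (p - q) + enorm (q - y) <= k].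

Lemma route_sym P0 P1 Q0 Q1 k x y :
  route P0 P1 Q0 Q1 k x y -> route Q0 Q1 P0 P1 k y x.
Proof.
move=> [p [q [hp hq h]]]; exists q, p; split=> //.
by rewrite (enorm_distC y q) (enorm_distC q p) (enorm_distC p x); lra.
Qed.

(** What [prism] asks of a family of routes: convexity in the pair of endpoints, for separation, and
    a Lipschitz property, which turns a gap in length into a gap in position. *)
Record robust (r : R -> 'rV[R]_3 -> 'rV[R]_3 -> Prop) : Prop := Robust {
  robust_conv : forall k x y x' y' t, r k x y -> r k x' y' -> 0 <= t -> t <= 1 ->
    r k ((1 - t) *: x + t *: x') ((1 - t) *: y + t *: y') ;
  robust_lip : forall k x y k' x' y', r k x y ->
    k + enorm (x' - x) + enorm (y' - y) <= k' -> r k' x' y' }.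

(** Crossing points are combined along with the endpoints, edges being convex and length a convex
    function; when the endpoints move, the crossing points stay. *)
Lemma route_robust P0 P1 Q0 Q1 : robust (route P0 P1 Q0 Q1).
Proof.
split=> [k x y x' y' t [p [q [hp hq h]]] [p' [q' [hp' hq' h']]] t0 t1|].
  exists ((1 - t) *: p + t *: p'), ((1 - t) *: q + t *: q').
  split; [exact: seg_conv | exact: seg_conv |].
  have xp := ler_enorm_conv x p x' p' t0 t1.
  have pq := ler_enorm_conv p q p' q' t0 t1.
  have qy := ler_enorm_conv q y q' y' t0 t1.
  have a1 : (1 - t) * (enorm (x - p) + enorm (p - q) + enorm (q - y)) <= (1 - t) * k.
    by rewrite ler_wpM2l // subr_ge0.
  have a2 : t * (enorm (x' - p') + enorm (p' - q') + enorm (q' - y')) <= t * k.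
    by rewrite ler_wpM2l.
  lra.
move=> k x y k' x' y' [p [q [hp hq h]]] h'.
exists p, q; split=> //.
have := ler_enorm_dist x x' p; have := ler_enorm_dist y q y'.
by rewrite (enorm_distC y y'); lra.
Qed.

(* The slack [k < k'] makes up for not knowing that route sets are closed. *)
Definition covered (r : 'I_3 -> R -> 'rV[R]_3 -> 'rV[R]_3 -> Prop) k x y :=
  forall k', k < k' -> exists i, r i k' x y.

(* In a domain of dimension 3 there is a direction along which one stays away
   from each of three separated convex sets, up to the boundary. *)
Lemma prism r k X0 X1 X2 Y0 Y1 : (forall i, robust (r i)) ->
    (forall x y, tri X0 X1 X2 x -> y = Y0 \/ y = Y1 -> covered r k x y) ->
    (forall x y, seg X0 X1 x \/ seg X1 X2 x \/ seg X0 X2 x -> seg Y0 Y1 y ->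
      covered r k x y) ->
  forall x y, tri X0 X1 X2 x -> seg Y0 Y1 y -> covered r k x y.
Proof.
move=> rob Htri Hseg x0 y0 [a [b [c [a_ge0 b_ge0 c_ge0 abc def_x0]]]]
  [t [t_ge0 t_le1 def_y0]] k' kk'.
apply: contrapT => nr.
pose i0 : 'I_3 := 0; pose i1 : 'I_3 := 1; pose i2 : 'I_3 := 2%:R.
(* The product of triangle and segment is parametrized by a prism [dom] in three-space: two
   barycentric weights and the position on the segment. Separation takes place there. *)
pose X (z : 'rV[R]_3) : 'rV[R]_3 := (1 - z 0 i0 - z 0 i1) *: X0 + z 0 i0 *: X1 + z 0 i1 *: X2.
pose Y (z : 'rV[R]_3) : 'rV[R]_3 := (1 - z 0 i2) *: Y0 + z 0 i2 *: Y1.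
pose dom (z : 'rV[R]_3) := [/\ 0 <= z 0 i0, 0 <= z 0 i1,
  0 <= 1 - z 0 i0 - z 0 i1, 0 <= z 0 i2 & 0 <= 1 - z 0 i2].
pose z0 : 'rV[R]_3 := \row_j [:: b; c; t]`_j.
have z00 : z0 0 i0 = b by rewrite mxE.
have z01 : z0 0 i1 = c by rewrite mxE.
have z02 : z0 0 i2 = t by rewrite mxE.
clearbody z0.
have Xz0 : X z0 = x0.
  by rewrite /X z00 z01 def_x0 -abc; congr (_ *: _ + _ + _); ring.
have Yz0 : Y z0 = y0 by rewrite /Y z02 def_y0.
have dom0 : dom z0 by rewrite /dom z00 z01 z02; split=> //; lra.
pose k2 := (k + k') / 2.
have kk2 : k < k2 by rewrite /k2; lra.
(* The boundary is still covered at [k2 > k], while a route of length [k2] for parameters too close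
   to [z0] would yield one of length [k'] at [z0]. *)
have k2k : k2 < k' by rewrite /k2; lra.
pose K i z := dom z /\ r i k2 (X z) (Y z).
(* A joint Lipschitz constant for [X] and [Y], made positive by the added 1. *)
pose L := enorm (X1 - X0) + enorm (X2 - X0) + enorm (Y1 - Y0) + 1.
have L0 : 0 < L.
  by rewrite /L ltr_wpDl // !addr_ge0 ?enorm_ge0.
have lip i z : K i z -> (k' - k2) / L <= enorm (z - z0).
  move=> [_ rz]; rewrite ler_pdivrMr // leNgt; apply/negP => small.
  apply: nr; exists i; rewrite -Xz0 -Yz0.
  apply: (robust_lip (rob i) rz).
  have -> : X z0 - X z = (z0 - z) 0 i0 *: (X1 - X0) + (z0 - z) 0 i1 *: (X2 - X0).
    by rewrite /X; rowring.
  have -> : Y z0 - Y z = (z0 - z) 0 i2 *: (Y1 - Y0).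
    by rewrite /Y; rowring.
  have := ler_enormD ((z0 - z) 0 i0 *: (X1 - X0)) ((z0 - z) 0 i1 *: (X2 - X0)).
  rewrite !enormZ => h.
  have coord j e : 0 <= e -> `|(z0 - z) 0 j| * e <= enorm (z0 - z) * e.
    by move=> e0; rewrite ler_wpM2r // ler_coord_enorm.
  have c0 := coord i0 _ (enorm_ge0 (X1 - X0)).
  have c1 := coord i1 _ (enorm_ge0 (X2 - X0)).
  have c2 := coord i2 _ (enorm_ge0 (Y1 - Y0)).
  move: small; rewrite (enorm_distC z) /L !mulrDr mulr1.
  have := enorm_ge0 (z0 - z); lra.
have bnd i z : K i z -> enorm (z - z0) <= 2.
  move=> [[h0 h1 h2 h3 h4] _]; rewrite enorm_leP // /dot !big_ord_recl big_ord0 !mxE.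
  have -> : lift ord0 (ord0 : 'I_2) = i1 by exact/val_inj.
  have -> : lift ord0 (lift ord0 (ord0 : 'I_1)) = i2 by exact/val_inj.
  rewrite -/i0 /=; nra.
have conv i : convex_pred (K i).
  move=> u v s [[u0 u1 u2 u3 u4] ru] [[v0 v1 v2 v3 v4] rv] s0 s1; split.
    by rewrite /dom !mxE; split; nra.
  have -> : X ((1 - s) *: u + s *: v) = (1 - s) *: X u + s *: X v.
    by rewrite /X !mxE; rowring.
  have -> : Y ((1 - s) *: u + s *: v) = (1 - s) *: Y u + s *: Y v.
    by rewrite /Y !mxE; rowring.
  exact: (robust_conv (rob i) ru rv s0 s1).
have del0 : 0 < (k' - k2) / L by rewrite divr_gt0 // subr_gt0.
have sep i := separation (conv i) del0 (lip i) (bnd i).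
pose g i := projT1 (cid (sep i)).
have gP i : forall u, K i u -> dot (g i) (u - z0) < 0 := projT2 (cid (sep i)).
have [v [v_neq0 gv]] := nonneg_direction g.
(* Value and slope of the five constraints of [dom] along the ray from [z0] in direction [v]. If no
   slope were negative, [v] would vanish. *)
pose cs := [:: (b, v 0 i0); (c, v 0 i1); (a, - v 0 i0 - v 0 i1);
               (t, v 0 i2); (1 - t, - v 0 i2)].
have cs_ge0 l : l \in cs -> 0 <= l.1.
  by rewrite !inE => /or4P[| | | /orP[]] /eqP-> //=; rewrite subr_ge0.
have cs_neg : exists2 l, l \in cs & l.2 < 0.
  apply: contrapT => no.
  have csp l : l \in cs -> 0 <= l.2.
    by move=> lcs; rewrite leNgt; apply/negP => ln; apply: no; exists l.
  have p0 := csp (b, v 0 i0); have p1 := csp (c, v 0 i1).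
  have p2 := csp (a, - v 0 i0 - v 0 i1); have p3 := csp (t, v 0 i2).
  have p4 := csp (1 - t, - v 0 i2).
  rewrite !inE !eqxx ?orbT /= in p0 p1 p2 p3 p4.
  have {}p0 := p0 isT; have {}p1 := p1 isT; have {}p2 := p2 isT.
  have {}p3 := p3 isT; have {}p4 := p4 isT.
  case/negP: v_neq0; apply/eqP/rowP => j; rewrite mxE.
  have [->|[->|->]] : j = i0 \/ j = i1 \/ j = i2; [|lra..].
  by case: j => [[|[|[|]]]] // ?; [left|right; left|right; right]; exact/val_inj.
have [s [s0 cs_s [l lcs ls]]] := first_exit cs_ge0 cs_neg.
pose w := z0 + s *: v.
have w0 : w 0 i0 = b + s * v 0 i0 by rewrite !mxE z00.
have w1 : w 0 i1 = c + s * v 0 i1 by rewrite !mxE z01.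
have w2 : w 0 i2 = t + s * v 0 i2 by rewrite !mxE z02.
have domw : dom w.
  have q0 := cs_s (b, v 0 i0); have q1 := cs_s (c, v 0 i1).
  have q2 := cs_s (a, - v 0 i0 - v 0 i1); have q3 := cs_s (t, v 0 i2).
  have q4 := cs_s (1 - t, - v 0 i2).
  rewrite !inE !eqxx ?orbT /= in q0 q1 q2 q3 q4.
  have {}q0 := q0 isT; have {}q1 := q1 isT; have {}q2 := q2 isT.
  have {}q3 := q3 isT; have {}q4 := q4 isT.
  by rewrite /dom w0 w1 w2; split=> //; lra.
have [d0 d1 d2 d3 d4] := domw.
have triw : tri X0 X1 X2 (X w).
  by exists (1 - w 0 i0 - w 0 i1), (w 0 i0), (w 0 i1); split=> //; ring.
have segw : seg Y0 Y1 (Y w) by exists (w 0 i2); split=> //; lra.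
have [i ri] : exists i, r i k2 (X w) (Y w).
  have bary : w 0 i0 = 0 \/ w 0 i1 = 0 \/ 1 - w 0 i0 - w 0 i1 = 0 \/
      w 0 i2 = 0 \/ 1 - w 0 i2 = 0.
    move: lcs ls; rewrite !inE => /or4P[| | | /orP[]] /eqP-> /= ls; rewrite w0 w1 w2.
    - by left.
    - by right; left.
    - by right; right; left; lra.
    - by right; right; right; left.
    - by do 4!right; lra.
  case: bary => [e|[e|[e|[e|e]]]].
  - apply: Hseg segw _ kk2; right; right; exists (w 0 i1); split=> //; first lra.
    by rewrite /X e subr0 scale0r addr0.
  - apply: Hseg segw _ kk2; left; exists (w 0 i0); split=> //; first lra.
    by rewrite /X e subr0 scale0r addr0.
  - apply: Hseg segw _ kk2; right; left; exists (w 0 i1); split=> //; first lra.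
    by rewrite /X e scale0r add0r; congr (_ *: _ + _); lra.
  - apply: Htri triw _ _ kk2; left.
    by rewrite /Y e subr0 scale0r addr0 scale1r.
  - apply: Htri triw _ _ kk2; right.
    have -> : Y w = w 0 i2 *: Y1 by rewrite /Y e scale0r add0r.
    by rewrite (_ : w 0 i2 = 1) ?scale1r //; lra.
(* Now [w] lies in [K i], although [dot (g i) (w - z0) = s * dot (g i) v] is nonnegative. *)
have := gP i w (conj domw ri); rewrite ltNge => /negP; apply.
by rewrite /w (addrC z0) addrK dotZr mulr_ge0.
Qed.

End Routes.

(** * Routes between two faces *)

Section Faces.
Variable R : realType.
Implicit Types (x y z p q A B C D P Q X Y : 'rV[R]_3) (k d t : R).

Definition on_boundary A B C q := seg A B q \/ seg B C q \/ seg A C q.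

Lemma on_boundary_tri A B C q : on_boundary A B C q -> tri A B C q.
Proof.
move=> [|[]] h; first exact: seg_tri.
  exact/tri_rot/tri_rot/seg_tri.
exact/tri_rot/tri_rot/tri_swap/tri_rot/seg_tri.
Qed.

(** Kept as an input to the reduction because this case alone determines [k]: 2 d / sqrt 3 in
    general, [d] for thick tetrahedra. *)
Definition vertex_face_le D A B C k := forall y, tri A B C y ->
  exists q, on_boundary A B C q /\ enorm (D - q) + enorm (q - y) <= k.

(* Route 0 crosses only AB; it is put in the two-edge format by taking both
   edges equal to AB. *)
Definition face_routes A B C D (i : 'I_3) : R -> 'rV[R]_3 -> 'rV[R]_3 -> Prop :=
  match val i with
  | 0%N => route A B A B
  | 1%N => route B C B D
  | _ => route A C A D
  end.

Lemma face_routes_sym A B C D k x y :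
  covered (face_routes A B C D) k x y -> covered (face_routes A B D C) k y x.
Proof.
move=> h k' /h[i hi]; exists i; move: i hi.
by case=> [[|[|[|]]]] // ?; exact: route_sym.
Qed.

Lemma face_routes_robust A B C D i : robust (face_routes A B C D i).
Proof. by case: i => [[|[|[|]]]] // ?; exact: route_robust. Qed.

Lemma route0 P0 P1 Q0 Q1 k x y p : seg P0 P1 p -> seg Q0 Q1 p ->
  enorm (x - p) + enorm (p - y) <= k -> route P0 P1 Q0 Q1 k x y.
Proof.
by move=> hp hq h; exists p, p; split=> //; rewrite subrr enorm0 addr0.
Qed.

Lemma covered0 A B C D k x y : route A B A B k x y -> covered (face_routes A B C D) k x y.
Proof.
move=> h k' kk'; exists 0.
apply: (robust_lip (face_routes_robust A B C D 0) (h : face_routes A B C D 0 k x y)).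
by rewrite !subrr enorm0 !addr0 ltW.
Qed.

Lemma covered1 A B C D k x y : route B C B D k x y -> covered (face_routes A B C D) k x y.
Proof.
move=> h k' kk'; exists 1.
apply: (robust_lip (face_routes_robust A B C D 1) (h : face_routes A B C D 1 k x y)).
by rewrite !subrr enorm0 !addr0 ltW.
Qed.

Lemma covered2 A B C D k x y : route A C A D k x y -> covered (face_routes A B C D) k x y.
Proof.
move=> h k' kk'; exists 2%:R.
apply: (robust_lip (face_routes_robust A B C D 2%:R) (h : face_routes A B C D 2%:R k x y)).
by rewrite !subrr enorm0 !addr0 ltW.
Qed.

(* With x and y at fractions l and m of the opposite edges BC and AD, the path
   through the point at fraction l of AC (if m <= l) runs parallel to AB first;
   the other case is symmetric. *)
Lemma opposite_edges A B C D d x y : seg B C x -> seg A D y ->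
    enorm (A - B) <= d -> enorm (A - C) <= d -> enorm (B - D) <= d ->
    enorm (C - D) <= d ->
  route B C B D d x y \/ route A C A D d x y.
Proof.
move=> [l [l0 l1 def_x]] [m [m0 m1 def_y]] AB AC BD CD.
have le_term (e : R) X : 0 <= e -> enorm X <= d -> enorm (e *: X) <= e * d.
  by move=> e0 Xd; rewrite enormZ ger0_norm // ler_wpM2l.
have [ml|lm] := leP m l.
  right; exists ((1 - l) *: A + l *: C), y; split; first by exists l.
    by exists m.
  have -> : x - ((1 - l) *: A + l *: C) = (1 - l) *: (B - A).
    by rewrite def_x; rowring.
  have -> : (1 - l) *: A + l *: C - y = (l - m) *: (C - A) + m *: (C - D).
    by rewrite def_y; rowring.
  rewrite subrr enorm0 addr0.
  have h := ler_enormD ((l - m) *: (C - A)) (m *: (C - D)).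
  have h1 : enorm ((1 - l) *: (B - A)) <= (1 - l) * d.
    by rewrite le_term ?subr_ge0 // enorm_distC.
  have h2 : enorm ((l - m) *: (C - A)) <= (l - m) * d.
    by rewrite le_term ?subr_ge0 // enorm_distC.
  have h3 := le_term _ _ m0 CD.
  lra.
left; exists x, ((1 - m) *: B + m *: D); split; first by exists l.
  by exists m.
have -> : (1 - m) *: B + m *: D - y = (1 - m) *: (B - A).
  by rewrite def_y; rowring.
have -> : x - ((1 - m) *: B + m *: D) = (m - l) *: (B - D) + l *: (C - D).
  by rewrite def_x; rowring.
rewrite subrr enorm0 add0r.
have h := ler_enormD ((m - l) *: (B - D)) (l *: (C - D)).
have h1 : enorm ((1 - m) *: (B - A)) <= (1 - m) * d.
  by rewrite le_term ?subr_ge0 // enorm_distC.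
have h2 : enorm ((m - l) *: (B - D)) <= (m - l) * d.
  by rewrite le_term ?subr_ge0 // ltW.
have h3 := le_term _ _ l0 CD.
lra.
Qed.

Lemma dot_lin (a b : R) (u v : 'rV[R]_3) : dot (a *: u + b *: v) (a *: u + b *: v) =
  a ^+ 2 * dot u u + b ^+ 2 * dot v v + 2 * a * b * dot u v.
Proof. by rewrite !dotE (dotC v u); ring. Qed.

(** The assumptions are symmetric in C and D, so each statement below can be reused with the faces
    ABC and ABD exchanged. *)
Record face_pair A B C D d k : Prop := FacePair {
  fp_ge0 : 0 <= d ; fp_dk : d <= k ;
  fp_AB : enorm (A - B) <= d ; fp_AC : enorm (A - C) <= d ;
  fp_AD : enorm (A - D) <= d ; fp_BC : enorm (B - C) <= d ;
  fp_BD : enorm (B - D) <= d ; fp_CD : enorm (C - D) <= d ;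
  fp_C : vertex_face_le C A B D k ; fp_D : vertex_face_le D A B C k }.

Lemma face_pair_sym A B C D d k : face_pair A B C D d k -> face_pair A B D C d k.
Proof. by case=> *; split=> //; rewrite enorm_distC. Qed.

(** Both points lie in ABD, so the straight segment serves, with [x] itself as crossing point. *)
Lemma edge_AB A B C D d k x y : face_pair A B C D d k ->
  seg A B x -> tri A B D y -> covered (face_routes A B C D) k x y.
Proof.
move=> fp hx hy; apply/covered0/(route0 hx hx); rewrite subrr enorm0 add0r.
apply: le_trans (fp_dk fp); apply: tri_dist2 (seg_tri _ hx) hy _ _ _.
- exact: fp_ge0 fp.
- exact: fp_AB fp.
- exact: fp_BD fp.
- exact: fp_AD fp.
Qed.

(** A and B fall under [edge_AB]. For C, the side of ABD crossed by the path of [fp_C] selects the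
    route. *)
Lemma vertex_face A B C D d k x y : face_pair A B C D d k ->
  x = A \/ x = B \/ x = C -> tri A B D y -> covered (face_routes A B C D) k x y.
Proof.
move=> fp [->|[->|->]] hy.
- by apply: edge_AB fp _ hy; exact: seg_l.
- by apply: edge_AB fp _ hy; exact: seg_r.
have [q [[hq|[hq|hq]] h]] := fp_C fp hy.
- exact/covered0/(route0 hq hq).
- by apply: covered1; exists C, q; split=> //; [exact: seg_r | rewrite subrr enorm0 add0r].
- by apply: covered2; exists C, q; split=> //; [exact: seg_r | rewrite subrr enorm0 add0r].
Qed.

(** Apart from points on AB, the two edges either share a vertex, and then a third face contains
    both points and their segment, or they are opposite. *)
Lemma edge_edge A B C D d k x y : face_pair A B C D d k ->
  on_boundary A B C x -> on_boundary A B D y -> covered (face_routes A B C D) k x y.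
Proof.
move=> fp hx hy.
have near_route P0 P1 Q0 Q1 : route P0 P1 Q0 Q1 d x y -> route P0 P1 Q0 Q1 k x y.
  move=> h; apply: (robust_lip (route_robust _ _ _ _) h).
  by rewrite !subrr enorm0 !addr0 (fp_dk fp).
have common Z : seg Z C x -> seg Z D y -> enorm (Z - C) <= d -> enorm (Z - D) <= d ->
    route Z C Z D d x y.
  move=> zx zy ZC ZD; exists x, y; split=> //; rewrite !subrr enorm0 add0r addr0.
  apply: (@tri_dist2 _ Z C D) => //.
  - exact: fp_ge0 fp.
  - exact: seg_tri.
  - exact/tri_rot/tri_rot/tri_swap/tri_rot/seg_tri.
  - exact: fp_CD fp.
case: hx => [hx|hx]; first exact: edge_AB fp hx (on_boundary_tri hy).
case: hy => [hy|hy].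
  apply: face_routes_sym; apply: edge_AB (face_pair_sym fp) hy _.
  by apply: on_boundary_tri; right.
case: hx => hx; case: hy => hy.
- by apply/covered1/near_route/common => //; [exact: fp_BC fp | exact: fp_BD fp].
- have [] := opposite_edges hx hy (fp_AB fp) (fp_AC fp) (fp_BD fp) (fp_CD fp).
    by move=> h; exact/covered1/near_route.
  by move=> h; exact/covered2/near_route.
- have := fp_AB fp; rewrite enorm_distC => BA.
  have [] := opposite_edges hx hy BA (fp_BC fp) (fp_AD fp) (fp_CD fp).
    by move=> h; exact/covered2/near_route.
  by move=> h; exact/covered1/near_route.
- by apply/covered2/near_route/common => //; [exact: fp_AC fp | exact: fp_AD fp].
Qed.

(** [prism] over ABC and one side of ABD: its two boundary conditions are [vertex_face], with the
    faces exchanged, and [edge_edge]. *)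
Lemma face_edge A B C D d k x y : face_pair A B C D d k ->
  tri A B C x -> on_boundary A B D y -> covered (face_routes A B C D) k x y.
Proof.
move=> fp hx hy.
have aux Y0 Y1 : (forall z, seg Y0 Y1 z -> on_boundary A B D z) ->
    (Y0 = A \/ Y0 = B \/ Y0 = D) -> (Y1 = A \/ Y1 = B \/ Y1 = D) ->
    seg Y0 Y1 y -> covered (face_routes A B C D) k x y.
  move=> sub e0 e1; apply: prism (face_routes_robust A B C D) _ _ _ _ hx => x' y' hx'.
    move=> hy'; apply: face_routes_sym; apply: vertex_face (face_pair_sym fp) _ hx'.
    by case: hy' => ->.
  by move=> /sub hy'; exact: edge_edge fp hx' hy'.
case: hy => [hy|[hy|hy]].
- by apply: aux hy; [left | left | right; left].
- by apply: aux hy; [right; left | right; left | right; right].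
- by apply: aux hy; [right; right | left | right; right].
Qed.

Lemma face_face A B C D d k x y : face_pair A B C D d k ->
  tri A B C x -> tri A B D y -> covered (face_routes A B C D) k x y.
Proof.
move=> fp hx [a [b [c [a0 b0 c0 abc def_y]]]].
(* The chord of ABD through [y] parallel to AB, a single point if [c = 1]. Its ends lie on AD and
   BD, so [prism] applies again, with [face_edge] for both boundary conditions. *)
pose Y0 := (1 - c) *: A + c *: D; pose Y1 := (1 - c) *: B + c *: D.
have c1 : c <= 1 by lra.
have h0 : on_boundary A B D Y0 by right; right; exists c.
have h1 : on_boundary A B D Y1 by right; left; exists c.
have hy : seg Y0 Y1 y.
  have [ab|ab] := eqVneq (a + b) 0.
    have a_eq0 : a = 0 by lra.
    have b_eq0 : b = 0 by lra.
    have c_eq1 : c = 1 by lra.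
    exists 0; split=> //; rewrite def_y /Y0 /Y1 a_eq0 b_eq0 c_eq1; rowring.
  have ab0 : 0 < a + b by rewrite lt_def ab addr_ge0.
  exists (b / (a + b)); split; first exact: divr_ge0 (ltW ab0).
    by rewrite ler_pdivrMr //; lra.
  have e1 : b / (a + b) * (1 - c) = b.
    by rewrite (_ : 1 - c = a + b) ?mulfVK //; lra.
  have e2 : (1 - b / (a + b)) * (1 - c) = a by rewrite mulrBl e1; lra.
  rewrite def_y /Y0 /Y1 !scalerDr !scalerA e1 e2.
  by rewrite addrACA -scalerDl (_ : (1 - _) * c + _ = c) //; ring.
apply: prism (face_routes_robust A B C D) _ _ _ _ hx hy => x' y' hx' hy'.
  by apply: face_edge fp hx' _; case: hy' => ->.
apply: face_routes_sym; apply: face_edge (face_pair_sym fp) _ hx'.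
have [t [t0 t1 ->]] := hy'.
by apply: tri_conv; [exact: on_boundary_tri | exact: on_boundary_tri | |].
Qed.

(* The path crosses BC at the foot of the bisector of the angle at y. *)
Lemma wide_angle_route B C D y d k : 0 <= d -> 0 <= k -> k ^+ 2 = 4 / 3 * d ^+ 2 ->
    enorm (B - C) <= d -> enorm (D - B) <= d -> enorm (D - C) <= d ->
    2 * dot (B - y) (C - y) <= - (enorm (B - y) * enorm (C - y)) ->
  exists q, seg B C q /\ enorm (D - q) + enorm (q - y) <= k.
Proof.
move=> d0 k0 k2 BC DB DC.
have := enorm_sqr (B - y); have := enorm_sqr (C - y).
have := enorm_ge0 (B - y); have := enorm_ge0 (C - y).
set b := enorm (B - y); set c := enorm (C - y) => c0 b0 cc bb wide.
have dk : d <= k by rewrite -ler_sqr ?nnegrE // k2; have := sqr_ge0 d; lra.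
have [s0|s_neq0] := eqVneq (b + c) 0.
  exists B; split; first exact: seg_l.
  by rewrite -/b; lra.
have s0 : 0 < b + c by rewrite lt_def s_neq0 addr_ge0.
set s := b + c in s_neq0 s0.
pose u := b / s; pose t := b * c / s.
have us : u * s = b by rewrite mulfVK.
have u0 : 0 <= u by rewrite divr_ge0 // ltW.
have u1 : u <= 1 by rewrite ler_pdivrMr // mul1r /s lerDl.
have uc : u * c = t by rewrite /u /t mulrAC.
have ub : (1 - u) * b = t by rewrite -uc mulrBl mul1r -{1}us /s; ring.
have ts : t * s = b * c by rewrite mulfVK.
have t0 : 0 <= t by rewrite divr_ge0 ?mulr_ge0 // ltW.
clearbody u t.
have BC2 : dot (B - C) (B - C) <= d ^+ 2 by rewrite -enorm_leP.
have BCE : dot (B - C) (B - C) = b ^+ 2 + c ^+ 2 - 2 * dot (B - y) (C - y).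
  have -> : B - C = 1 *: (B - y) + (-1) *: (C - y) by rowring.
  by rewrite dot_lin cc bb; ring.
(* By the law of cosines b^2 + b c + c^2 <= d^2, and 4/3 of the left side exceeds s^2 by (b - c)^2 /
   3. *)
have sk : s <= k.
  rewrite -ler_sqr ?nnegrE ?(ltW s0) // k2 /s.
  have := sqr_ge0 (b - c); nra.
have t4 : t <= s / 4.
  rewrite -(ler_pM2r s0) ts; have := sqr_ge0 (b - c); rewrite /s; nra.
exists ((1 - u) *: B + u *: C); split; first by exists u.
have -> : D - ((1 - u) *: B + u *: C) = (1 - u) *: (D - B) + u *: (D - C) by rowring.
have -> : (1 - u) *: B + u *: C - y = (1 - u) *: (B - y) + u *: (C - y) by rowring.
have qy : enorm ((1 - u) *: (B - y) + u *: (C - y)) <= t.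
  rewrite enorm_leP // dot_lin -bb -cc.
  have -> : (1 - u) ^+ 2 * b ^+ 2 + u ^+ 2 * c ^+ 2
      + 2 * (1 - u) * u * dot (B - y) (C - y) =
    ((1 - u) * b) ^+ 2 + (u * c) ^+ 2 + u * (1 - u) * (2 * dot (B - y) (C - y)) by ring.
  rewrite ub uc.
  have : u * (1 - u) * (2 * dot (B - y) (C - y)) <= u * (1 - u) * - (b * c).
    by rewrite ler_wpM2l // mulr_ge0 // subr_ge0.
  have -> : u * (1 - u) * - (b * c) = - (((1 - u) * b) * (u * c)) by ring.
  by rewrite ub uc; lra.
have Dq : enorm ((1 - u) *: (D - B) + u *: (D - C)) <= k - t.
  rewrite enorm_leP; last by lra.
  (* Stewart's theorem for the segment from D to a point of BC. *)
  have -> : dot ((1 - u) *: (D - B) + u *: (D - C)) ((1 - u) *: (D - B) + u *: (D - C))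
    = (1 - u) * dot (D - B) (D - B) + u * dot (D - C) (D - C)
      - u * (1 - u) * dot (B - C) (B - C).
    have -> : B - C = 1 *: (D - C) + (-1) *: (D - B) by rowring.
    by rewrite !dot_lin (dotC (D - C)); ring.
  have DB2 : (1 - u) * dot (D - B) (D - B) <= (1 - u) * d ^+ 2.
    by rewrite ler_wpM2l ?subr_ge0 // -enorm_leP.
  have DC2 : u * dot (D - C) (D - C) <= u * d ^+ 2.
    by rewrite ler_wpM2l // -enorm_leP.
  have BC3 : u * (1 - u) * (s ^+ 2 - b * c) <= u * (1 - u) * dot (B - C) (B - C).
    rewrite ler_wpM2l ?mulr_ge0 ?subr_ge0 // BCE /s; lra.
  have e : u * (1 - u) * (s ^+ 2 - b * c) = t * s - t ^+ 2.
    have -> : u * (1 - u) * (s ^+ 2 - b * c) =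
      (u * s) * (s - u * s) - ((1 - u) * b) * (u * c) by ring.
    by rewrite us ub uc ts /s; ring.
  (* Stewart's theorem bounds the square by d^2 - t s + t^2. Since k^2 - d^2 = k^2 / 4, it remains
     to see t (2 k - s) <= k^2 / 4, which follows from [t4] and (k - s)^2 >= 0. *)
  have : t * (2 * k - s) <= s / 4 * (2 * k - s) by rewrite ler_wpM2r //; lra.
  have := sqr_ge0 (k - s).
  rewrite !sqrrB => h1 h2; nra.
by lra.
Qed.

(* If no angle at y is that wide, the vanishing combination of A - y, B - y, C - y given by the
   barycentric coordinates of y would have positive norm. *)
Lemma wide_angle A B C y : tri A B C y ->
  let wide P Q := 2 * dot (P - y) (Q - y) <= - (enorm (P - y) * enorm (Q - y)) in
  wide A B \/ wide B C \/ wide A C.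
Proof.
move=> [a [b [c [a0 b0 c0 abc def_y]]]] wide; apply: contrapT => nwide.
have nAB : ~ wide A B by move=> h; apply: nwide; left.
have nBC : ~ wide B C by move=> h; apply: nwide; right; left.
have nAC : ~ wide A C by move=> h; apply: nwide; right; right.
move: nAB nBC nAC; rewrite /wide => /negP nAB /negP nBC /negP nAC.
rewrite -!ltNge in nAB nBC nAC.
have comb : a *: (A - y) + b *: (B - y) + c *: (C - y) = 0.
  have -> : a *: (A - y) + b *: (B - y) + c *: (C - y) =
    a *: A + b *: B + c *: C - (a + b + c) *: y by rowring.
  by rewrite abc scale1r -def_y subrr.
have not_A P Q : P - y = 0 ->
    ~ - (enorm (P - y) * enorm (Q - y)) < 2 * dot (P - y) (Q - y).
  by move=> ->; rewrite enorm0 mul0r dot0l mulr0 oppr0 ltxx.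
(* A single nonzero weight places [y] at a vertex, where the angle inequality holds trivially as 0
   <= 0. *)
have yA : b = 0 -> c = 0 -> False.
  move=> eb ec; apply: (not_A A B) nAB.
  by move: comb; rewrite eb ec !scale0r !addr0 (_ : a = 1) ?scale1r //; lra.
have yB : a = 0 -> c = 0 -> False.
  move=> ea ec; apply: (not_A B C) nBC.
  by move: comb; rewrite ea ec !scale0r addr0 add0r (_ : b = 1) ?scale1r //; lra.
have yC : a = 0 -> b = 0 -> False.
  move=> ea eb; apply: (not_A C A); last by rewrite dotC mulrC.
  by move: comb; rewrite ea eb !scale0r !add0r (_ : c = 1) ?scale1r //; lra.
have := congr1 (fun v => dot v v) comb; rewrite /= dot0l.
have := enorm_sqr (A - y); have := enorm_sqr (B - y); have := enorm_sqr (C - y).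
move: nAB nBC nAC.
move: (A - y) (B - y) (C - y) => u v w; rewrite !dotE (dotC v u) (dotC w u) (dotC w v).
set uv := dot u v; set vw := dot v w; set uw := dot u w.
set m := enorm u; set n := enorm v; set o := enorm w => nAB nBC nAC <- <- <- zero.
(* By [zero], the sum of the three products in [p1], [p2], [p3] is minus half the sum of these
   squares. So each product is 0, hence two of the weights vanish. *)
have m0 := sqr_ge0 (a * m - b * n); have n0 := sqr_ge0 (b * n - c * o).
have o0 := sqr_ge0 (a * m - c * o).
have ab0 : 0 <= a * b by rewrite mulr_ge0.
have bc0 : 0 <= b * c by rewrite mulr_ge0.
have ac0 : 0 <= a * c by rewrite mulr_ge0.
have p1 : 0 <= a * b * (2 * uv + m * n) by rewrite mulr_ge0 //; lra.
have p2 : 0 <= b * c * (2 * vw + n * o) by rewrite mulr_ge0 //; lra.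
have p3 : 0 <= a * c * (2 * uw + m * o) by rewrite mulr_ge0 //; lra.
have tot : a * b * (2 * uv + m * n) + b * c * (2 * vw + n * o) +
    a * c * (2 * uw + m * o) <= 0 by nra.
have null (e f : R) : e * f = 0 -> 0 < f -> e = 0.
  by move=> /eqP; rewrite mulf_eq0 => /orP[/eqP|/eqP->] //; rewrite ltxx.
have /eqP ab_eq0 : a * b = 0 by apply: (null _ (2 * uv + m * n)); lra.
have /eqP bc_eq0 : b * c = 0 by apply: (null _ (2 * vw + n * o)); lra.
have /eqP ac_eq0 : a * c = 0 by apply: (null _ (2 * uw + m * o)); lra.
move: ab_eq0 bc_eq0 ac_eq0; rewrite !mulf_eq0.
by do 3![case/orP => /eqP ?]; auto.
Qed.

Lemma vertex_face_le_wide A B C D d k : 0 <= d -> 0 <= k -> k ^+ 2 = 4 / 3 * d ^+ 2 ->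
    enorm (A - B) <= d -> enorm (B - C) <= d -> enorm (A - C) <= d ->
    enorm (D - A) <= d -> enorm (D - B) <= d -> enorm (D - C) <= d ->
  vertex_face_le D A B C k.
Proof.
move=> d0 k0 kd AB BC AC DA DB DC y /wide_angle/= [|[]] wide.
- have [q [hq h]] := wide_angle_route d0 k0 kd AB DA DB wide.
  by exists q; split=> //; left.
- have [q [hq h]] := wide_angle_route d0 k0 kd BC DB DC wide.
  by exists q; split=> //; right; left.
- have [q [hq h]] := wide_angle_route d0 k0 kd AC DA DC wide.
  by exists q; split=> //; right; right.
Qed.

End Faces.

(** * Curves *)

Section Curves.
Variable R : realType.
Implicit Types (g : R -> 'rV[R]_3) (x y p q : 'rV[R]_3) (a b t : R).

(** A recursive [inscribed_length] with variable starting time, suited to induction on the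
    partition. *)
Fixpoint chain_length g a (s : seq R) : R :=
  if s is b :: s' then enorm (g b - g a) + chain_length g b s' else 0.

Lemma inscribed_lengthE g s : inscribed_length g s = chain_length g 0 s.
Proof.
suff aux a : \sum_(0 <= n < size s)
    enorm (g (nth 1 (a :: s) n.+1) - g (nth 1 (a :: s) n)) = chain_length g a s.
  exact: aux.
elim: s a => [|b s IHs] a /=; first by rewrite big_geq.
by rewrite big_nat_recl //= IHs.
Qed.

Lemma chain_length_le_curve_length g s :
  itv_partition 0 1 s -> ((chain_length g 0 s)%:E <= curve_length g)%E.
Proof. by move=> ps; apply: ereal_sup_ubound; exists s; rewrite ?inscribed_lengthE. Qed.

Lemma enorm_le_curve_length g : ((enorm (g 1 - g 0))%:E <= curve_length g)%E.
Proof.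
have := chain_length_le_curve_length g (itv_partition1 (@ltr01 R)).
by rewrite /= addr0.
Qed.

(** The increments of [phi] dominate the chords and telescope along any partition. *)
Lemma curve_length_le g (phi : R -> R) :
    (forall s t, s <= t -> enorm (g t - g s) <= phi t - phi s) ->
  (curve_length g <= (phi 1 - phi 0)%:E)%E.
Proof.
move=> gphi; apply: ge_ereal_sup => _ [s [ps /eqP ls] <-].
rewrite lee_fin inscribed_lengthE -ls.
elim: s (0 : R) ps {ls} => [|b s IHs] a /=; first by rewrite subrr.
move=> /andP[ab /IHs h]; apply: le_trans (lerD (gphi _ _ (ltW ab)) h) _.
by rewrite addrC subrKA.
Qed.

Definition clamp t : R := Num.max 0 (Num.min 1 t).

Lemma clamp_le0 t : t <= 0 -> clamp t = 0.
Proof. by move=> t0; rewrite /clamp min_r ?max_l //; lra. Qed.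

Lemma clamp_ge1 t : 1 <= t -> clamp t = 1.
Proof. by move=> t1; rewrite /clamp min_l ?max_r //; lra. Qed.

Lemma clamp_itv t : 0 <= t -> t <= 1 -> clamp t = t.
Proof. by move=> t0 t1; rewrite /clamp min_r ?max_r. Qed.

Lemma clamp_homo s t : s <= t -> clamp s <= clamp t.
Proof. by move=> st; rewrite /clamp le_max2 // le_min2. Qed.

Lemma clamp_continuous (a b : R) : continuous (fun t => clamp (a * t - b)).
Proof.
move=> t; have c0 : {for t, continuous (cst 0 : R -> R^o)} by exact: cvg_cst.
have c1 : {for t, continuous (cst 1 : R -> R^o)} by exact: cvg_cst.
have lin : {for t, continuous (fun s => a * s - b : R^o)}.
  by apply: cvgB; [apply: cvgM; [exact: cvg_cst | exact: cvg_id] | exact: cvg_cst].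
exact: (continuous_max c0 (continuous_min c1 lin)).
Qed.

Lemma intrinsic_dist_le S x p q y : seg x p `<=` S -> seg p q `<=` S ->
    seg q y `<=` S ->
  (intrinsic_dist S x y <= (enorm (x - p) + enorm (p - q) + enorm (q - y))%:E)%E.
Proof.
move=> xpS pqS qyS.
(* The clock of the leg numbered [i] from 0: it runs from 0 to 1 during one third of the time
   interval and is constant outside, so [g] runs through the three legs in turn and [phi] is the
   length covered so far. *)
pose c (i : R) t := clamp (3 * t - i).
have c0 i : 0 <= i -> c i 0 = 0 by move=> i0; rewrite /c clamp_le0 //; lra.
have c1 i : i <= 2 -> c i 1 = 1 by move=> i0; rewrite /c clamp_ge1 //; lra.
pose g t := x + c 0 t *: (p - x) + c 1 t *: (q - p) + c 2 t *: (y - q).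
pose phi t := c 0 t * enorm (p - x) + c 1 t * enorm (q - p) + c 2 t * enorm (y - q).
have len : (curve_length g <= (phi 1 - phi 0)%:E)%E.
  apply: curve_length_le => s t st.
  have cst i : 0 <= c i t - c i s.
    by rewrite subr_ge0 clamp_homo // lerD2r ler_pM2l.
  have -> : g t - g s = (c 0 t - c 0 s) *: (p - x) + (c 1 t - c 1 s) *: (q - p) +
      (c 2 t - c 2 s) *: (y - q) by rewrite /g; rowring.
  apply: le_trans (ler_enormD _ _) _.
  have h := ler_enormD ((c 0 t - c 0 s) *: (p - x)) ((c 1 t - c 1 s) *: (q - p)).
  by move: h; rewrite !enormZ !ger0_norm // /phi; lra.
have phiE : phi 1 - phi 0 = enorm (x - p) + enorm (p - q) + enorm (q - y).
  rewrite /phi !c0 // !c1 ?ler1n //.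
  by rewrite (enorm_distC x) (enorm_distC p q) (enorm_distC q y); lra.
rewrite -phiE; apply: le_trans len; apply: ereal_inf_lbound; exists g => //.
split.
- apply: continuous_subspaceT => t.
  have cc i (z : 'rV[R]_3) : (fun s => c i s *: z) @ t --> c i t *: z.
    by apply: cvgZr_tmp; exact: clamp_continuous.
  by apply: cvgD (cc _ _); apply: cvgD (cc _ _); apply: cvgD (cc _ _); exact: cvg_cst.
- by rewrite /g !c0 // !scale0r !addr0.
- rewrite /g !c1 ?ler1n // !scale1r; rowring.
move=> _ [t t01 <-]; move: t01; rewrite /= in_itv /= => /andP[t0 t1].
have [t3|t3] := leP t (1 / 3).
  apply: xpS; exists (c 0 t); rewrite /g /c clamp_itv; [|lra|lra].
  split; [lra | lra |].
  by rewrite (@clamp_le0 (3 * t - 1)) ?(@clamp_le0 (3 * t - 2)); [rowring | lra | lra].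
have [t4|t4] := leP t (2 / 3).
  apply: pqS; exists (c 1 t); rewrite /g /c (@clamp_itv (3 * t - 1)); [|lra|lra].
  split; [lra | lra |].
  by rewrite (@clamp_ge1 (3 * t - 0)) ?(@clamp_le0 (3 * t - 2)); [rowring | lra | lra].
apply: qyS; exists (c 2 t); rewrite /g /c (@clamp_itv (3 * t - 2)); [|lra|lra].
split; [lra | lra |].
by rewrite (@clamp_ge1 (3 * t - 0)) ?(@clamp_ge1 (3 * t - 1)); [rowring | lra | lra].
Qed.

(* Follow the curve up to its last exit from the closed set it starts in, which
   can then be dropped from the cover. *)
Lemma piecewise_lipschitz_chain (I : choiceType) (C : I -> set R) g (h : R -> R) ks a b :
    uniq ks -> a <= b -> (forall i, closed (C i)) ->
    (forall i s t, C i s -> C i t -> h t - h s <= enorm (g t - g s)) ->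
    (forall t, a <= t -> t <= b -> exists2 i, i \in ks & C i t) ->
  exists2 s, itv_partition a b s & h b - h a <= chain_length g a s.
Proof.
move=> ks_uniq ab Cclosed Clip.
move: {2}(size ks) (erefl (size ks)) => n.
elim: n ks ks_uniq a ab => [|n IHn] ks ks_uniq a ab szks cov.
  have [i iks _] := cov a (lexx a) ab.
  by move/eqP: szks; rewrite size_eq0 => /eqP ks0; rewrite ks0 in iks.
have [i iks Cia] := cov a (lexx a) ab.
pose D := C i `&` `[a, b].
have Db : has_ubound D by exists b => t [_]; rewrite /= in_itv /= => /andP[].
have Da : D a by split=> //=; rewrite in_itv /= lexx.
have D0 : D !=set0 by exists a.
pose m := sup D.
have Dm : D m.
  have Dclosed : closed D by apply: closedI; [exact: Cclosed | exact: itv_closed].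
  rewrite (closure_id D).1 //; exact: closure_sup.
have [Cim] := Dm; rewrite /= in_itv /= => /andP[am mb].
have after t : m < t -> t <= b -> exists2 j, j \in rem i ks & C j t.
  move=> mt tb; have [j jks Cjt] := cov t (le_trans am (ltW mt)) tb.
  exists j => //; rewrite (rem_filter _ ks_uniq) mem_filter jks andbT /=.
  apply/eqP => ji; have := mt; rewrite ltNge => /negP; apply.
  apply: ub_le_sup => //; split; first by rewrite -ji.
  by rewrite /= in_itv /= tb (le_trans am (ltW mt)).
have cons_chain s : itv_partition m b s -> h b - h m <= chain_length g m s ->
    exists2 s, itv_partition a b s & h b - h a <= chain_length g a s.
  move=> [ps ls] hs.
  have := Clip _ _ _ Cia Cim.
  (* Partitions are strictly increasing, so [m] is prepended only when it differs from [a]. *)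
  move: am; rewrite le_eqVlt => /orP[/eqP am|am] hm; first by exists s; rewrite am.
  exists (m :: s) => /=; last by lra.
  by split; rewrite /= ?am.
move: mb; rewrite le_eqVlt => /orP[/eqP mb|mb].
  apply: (cons_chain [::]); last by rewrite mb subrr.
  by split=> //=; rewrite mb.
(* The remaining sets cover the times just after [m]; their union is closed, being finite, so it
   contains [m] too and the induction can restart there. *)
have atm : exists2 j, j \in rem i ks & C j m.
  have Uclosed : closed (\bigcup_(j in [set` rem i ks]) C j).
    by rewrite bigcup_seq; apply: closed_bigsetU => j _; exact: Cclosed.
  suff : (\bigcup_(j in [set` rem i ks]) C j) m by move=> [j jks Cjm]; exists j.
  apply: Uclosed => V /nbhs_ballP[e /= e0 mV].
  pose t := Num.min b (m + e / 2).
  have mt : m < t by rewrite lt_min mb ltrDl divr_gt0.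
  have tb : t <= b by rewrite ge_min lexx.
  exists t; split; first by have [j jks Cjt] := after t mt tb; exists j.
  apply: mV; rewrite /ball /= ltr0_norm; last by lra.
  have : t <= m + e / 2 by rewrite ge_min lexx orbT.
  by lra.
have [||s ps hs] := IHn (rem i ks) (rem_uniq i ks_uniq) m (ltW mb).
- by rewrite size_rem // szks.
- move=> t mt tb; move: mt; rewrite le_eqVlt => /orP[/eqP <- //|mt].
  exact: after.
exact: cons_chain ps hs.
Qed.

End Curves.

(** * Upper bounds for the intrinsic diameter *)

(** By counting. [uniq [:: i; j; k; l]] is the way below to label all four vertices in an arbitrary
    order. *)
Lemma uniq4_mem (i j k l m : 'I_4) : uniq [:: i; j; k; l] -> m \in [:: i; j; k; l].
Proof.
move=> u; have sub : {subset [:: i; j; k; l] <= enum 'I_4}.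
  by move=> ? _; rewrite mem_enum.
have szs : (size (enum 'I_4) <= size [:: i; j; k; l])%N by rewrite size_enum_ord.
by have [_ ->] := uniq_min_size u sub szs; rewrite mem_enum.
Qed.

Lemma sum_uniq4 (V : nmodType) (F : 'I_4 -> V) i j k l :
  uniq [:: i; j; k; l] -> \sum_m F m = F i + F j + F k + F l.
Proof.
move=> u; transitivity (\sum_(m <- [:: i; j; k; l]) F m).
  by rewrite [RHS]big_uniq //; apply: eq_bigl => m; rewrite uniq4_mem.
by rewrite !big_cons big_nil addr0 !addrA.
Qed.

Lemma uniq4_ex (i j : 'I_4) : i != j -> exists k l, uniq [:: i; j; k; l].
Proof.
move=> ij; pose A : {set 'I_4} := [set i; j]%SET.
have : #|(~: A)%SET| == 2%N.
  by rewrite -(eqn_add2l #|A|) cardsC card_ord cards2 ij.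
move=> /cards2P[k [l [kl e]]]; exists k, l.
have : k \in (~: A)%SET by rewrite e !inE eqxx.
have : l \in (~: A)%SET by rewrite e !inE eqxx orbT.
rewrite !inE !negb_or => /andP[li lj] /andP[ki kj].
by rewrite /= !inE !negb_or ij kl (eq_sym i) ki (eq_sym i) li (eq_sym j) kj eq_sym lj.
Qed.

Lemma uniq4_rot (i j k l : 'I_4) : uniq [:: i; j; k; l] -> uniq [:: j; k; l; i].
Proof. by rewrite -(rot_uniq 1). Qed.

Lemma uniq4_swap (i j k l : 'I_4) : uniq [:: i; j; k; l] -> uniq [:: j; i; k; l].
Proof. by rewrite /= !inE !negb_or (eq_sym j i) => /and4P[/and3P[-> -> ->] /andP[-> ->] -> _]. Qed.

Section Tetra.
Variable R : realType.
Variable T : tetrahedron R.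
Local Notation V := (vertex T).
Implicit Types (x y q : 'rV[R]_3) (i j k l : 'I_4) (d K : R).

Lemma faceE i j k l x : uniq [:: i; j; k; l] ->
  face T i x <-> tri (V j) (V k) (V l) x.
Proof.
move=> u; split.
  move=> [w [w0 w1 wi ->]]; exists (w j), (w k), (w l); split=> //.
    by rewrite -w1 (sum_uniq4 _ u) wi add0r.
  by rewrite (sum_uniq4 _ u) wi scale0r add0r.
move=> [a [b [c [a0 b0 c0 abc ->]]]].
exists (fun m => if m == j then a else if m == k then b else if m == l then c else 0).
move: (u); rewrite /= !inE !negb_or => /and4P[/and3P[ij ik il] /andP[jk jl] kl _].
have [kj [lj lk]] : (k == j = false) /\ (l == j = false) /\ (l == k = false).
  by rewrite !(eq_sym l) (eq_sym k) !(negbTE jk, negbTE jl, negbTE kl).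
split.
- by move=> m; do 3!case: ifP => // _.
- by rewrite (sum_uniq4 _ u) !(negbTE ij, negbTE ik, negbTE il) !eqxx kj lj lk add0r.
- by rewrite !(negbTE ij, negbTE ik, negbTE il).
rewrite (sum_uniq4 _ u) !(negbTE ij, negbTE ik, negbTE il) !eqxx kj lj lk.
by rewrite scale0r add0r.
Qed.

Lemma surface_face i x : face T i x -> surface T x.
Proof. by move=> h; exists i. Qed.

Lemma face_ex i : exists j k l, uniq [:: i; j; k; l].
Proof.
have [j ji] : exists j, j != i.
  have [->|i0] := eqVneq i 0; first by exists 1.
  by exists 0; rewrite eq_sym.
rewrite eq_sym in ji.
by have [k [l u]] := uniq4_ex ji; exists j, k, l.
Qed.

Lemma seg_surface i x y : face T i x -> face T i y -> seg x y `<=` surface T.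
Proof.
have [j [k [l u]]] := face_ex i.
move=> /(faceE _ u) hx /(faceE _ u) hy z [t [t0 t1 ->]].
by apply: (@surface_face i); apply/(faceE _ u)/tri_conv.
Qed.

Lemma vertex_surface i : surface T (V i).
Proof.
have [j [k [l u]]] := face_ex i.
apply: (@surface_face j); apply/(faceE _ (uniq4_rot u)).
exact/tri_rot/seg_tri/seg_l.
Qed.

Lemma surface_dist x y d : surface T x -> (forall i, enorm (V i - y) <= d) ->
  enorm (x - y) <= d.
Proof.
move=> [i _]; have [j [k [l u]]] := face_ex i.
by move=> /(faceE _ u) hx h; apply: (tri_dist hx).
Qed.

Lemma longest_edge_ex : exists i j, longest_edge T i j.
Proof.
pose P (p : 'I_4 * 'I_4) := p.1 != p.2.
have P01 : P (0, 1) by [].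
have [p Pp pmax] := arg_maxP (fun p => edge_length T p.1 p.2) P01.
by exists p.1, p.2; split=> // k l kl; exact: (pmax (k, l)).
Qed.

Lemma longest_edge_le i j k l : longest_edge T i j ->
  enorm (V k - V l) <= edge_length T i j.
Proof.
move=> [_ h]; have [->|kl] := eqVneq k l; last exact: h.
by rewrite subrr enorm0 enorm_ge0.
Qed.

(** Otherwise all vertices coincide and the matrix of edge vectors has rank 0 rather than 3. *)
Lemma longest_edge_gt0 i j : longest_edge T i j -> 0 < edge_length T i j.
Proof.
move=> ij; rewrite lt_def enorm_ge0 andbT; apply/eqP => d0.
have := vertex_row_free T; rewrite /row_free.
suff -> : \matrix_(m < 3) (V (lift ord0 m) - V ord0) = 0 by rewrite mxrank0.
apply/row_matrixP => m; rewrite rowK row0; apply: enorm_eq0.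
apply/eqP; rewrite eq_le enorm_ge0 andbT -d0.
exact: (longest_edge_le _ _ ij).
Qed.

(** The distance is convex in each argument, so its maximum is attained at vertices. *)
Lemma extrinsic_diamE i j : longest_edge T i j ->
  extrinsic_diam (surface T) = (edge_length T i j)%:E.
Proof.
move=> ij; apply/eqP; rewrite eq_le; apply/andP; split.
  apply: ge_ereal_sup => _ [[x y] [/= Sx Sy] <-]; rewrite lee_fin.
  apply: surface_dist Sx _ => k; rewrite enorm_distC; apply: surface_dist Sy _ => l.
  exact: longest_edge_le.
apply: ereal_sup_ubound; exists (V i, V j) => //.
by split; exact: vertex_surface.
Qed.

Lemma extrinsic_le_intrinsic : (extrinsic_diam (surface T) <= intrinsic_diam (surface T))%E.
Proof.
apply: ge_ereal_sup => _ [[x y] [/= Sx Sy] <-].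
apply: (@le_trans _ _ (intrinsic_dist (surface T) x y)); last first.
  by apply: ereal_sup_ubound; exists (x, y).
apply: le_ereal_inf_tmp => _ [g [_ <- <- _] <-].
by rewrite enorm_distC; exact: enorm_le_curve_length.
Qed.

(** A form of [vertex_face_le] that does not order the other three vertices, so it can be required
    of every [i]. *)
Definition vertex_le K i := forall y, face T i y -> exists q k l,
  [/\ k != l, k != i, l != i, seg (V k) (V l) q &
      enorm (V i - q) + enorm (q - y) <= K].

Lemma vertex_leP K i j k l : uniq [:: i; j; k; l] ->
  vertex_le K i <-> vertex_face_le (V i) (V j) (V k) (V l) K.
Proof.
move=> u; move: (u); rewrite /= !inE !negb_or => /and4P[/and3P[ij ik il] /andP[jk jl] kl _].
split=> h y hy; last first.
  have /h[q [hq qK]] := (faceE _ u).1 hy.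
  by case: hq => [|[]] hq; [exists q, j, k|exists q, k, l|exists q, j, l];
    split; rewrite // eq_sym.
have [q [k' [l' [kl' ki' li' hq qK]]]] := h y ((faceE _ u).2 hy).
exists q; split=> //.
have := uniq4_mem k' u; have := uniq4_mem l' u; rewrite !inE (negbTE ki') (negbTE li') /=.
move=> /or3P[] /eqP el /or3P[] /eqP ek; move: kl'; rewrite el ek ?eqxx // => _;
  rewrite el ek in hq.
all: by [left | left; exact: seg_sym | right; left | right; left; exact: seg_sym
        | right; right | right; right; exact: seg_sym].
Qed.

Lemma intrinsic_diam_le d K : d <= K -> (forall k l, enorm (V k - V l) <= d) ->
  (forall i, vertex_le K i) -> (intrinsic_diam (surface T) <= K%:E)%E.
Proof.
move=> dK Vd VK; apply: ge_ereal_sup => _ [[x y] [/= Sx Sy] <-].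
have [i _ xi] := Sx; have [j _ yj] := Sy.
have d0 : 0 <= d by exact: le_trans (enorm_ge0 _) (Vd 0 0).
have [eij|ij] := eqVneq i j.
  rewrite -eij in yj.
  have xS : seg x x `<=` surface T by exact: (seg_surface xi xi).
  apply: le_trans (intrinsic_dist_le xS xS (seg_surface xi yj)) _.
  rewrite lee_fin subrr enorm0 !add0r; apply: le_trans dK.
  apply: surface_dist Sx _ => k; rewrite enorm_distC; apply: surface_dist Sy _ => l.
  exact: Vd.
have [k [l u]] := uniq4_ex ij.
have uj : uniq [:: j; k; l; i] := uniq4_rot u.
have ui : uniq [:: i; k; l; j].
  by move: u; apply: etrans; apply: perm_uniq; rewrite perm_cons perm_sym (perm_catC [:: j]).
have uk : uniq [:: k; l; j; i].
  by move: u; apply: etrans; apply: perm_uniq; rewrite (perm_catC [:: k; l]) (perm_catCA [:: j] [:: i]).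
have ul : uniq [:: l; k; j; i] by exact: uniq4_swap.
(* The faces opposite to [i] and [j] share the edge from [V k] to [V l], which takes the place of
   AB. *)
have fp : face_pair (V k) (V l) (V j) (V i) d K.
  by split=> //; apply/vertex_leP.
have hx : tri (V k) (V l) (V j) x by exact/(faceE _ ui).
have hy : tri (V k) (V l) (V i) y by exact/(faceE _ uj).
have cov := face_face fp hx hy.
apply/lee_addgt0Pr => e e0.
have [|r] := cov (K + e); first by rewrite ltrDl.
have edge_i p : on_boundary (V k) (V l) (V j) p -> face T i p.
  by move=> /on_boundary_tri hp; exact/(faceE _ ui).
have edge_j p : on_boundary (V k) (V l) (V i) p -> face T j p.
  by move=> /on_boundary_tri hp; exact/(faceE _ uj).
have edge_k p : on_boundary (V l) (V j) (V i) p -> face T k p.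
  by move=> /on_boundary_tri hp; exact/(faceE _ uk).
have edge_l p : on_boundary (V k) (V j) (V i) p -> face T l p.
  by move=> /on_boundary_tri hp; exact/(faceE _ ul).
have fin p q m : face T i p -> face T m p -> face T m q -> face T j q ->
    enorm (x - p) + enorm (p - q) + enorm (q - y) <= K + e ->
    (intrinsic_dist (surface T) x y <= K%:E + e%:E)%E.
  move=> pi pm qm qj h; rewrite -EFinD.
  apply: le_trans (intrinsic_dist_le (seg_surface xi pi) (seg_surface pm qm)
    (seg_surface qj yj)) _.
  by rewrite lee_fin.
(* The middle leg lies in face [i] (on the common edge) for route 0, in face [k] for route 1 and in
   face [l] for route 2. *)
case: r => [[|[|[|//]]] ?] /= [p [q [hp hq]]]; apply: fin.
- by apply: edge_i; left.
- by apply: edge_i; left.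
- by apply: edge_i; left.
- by apply: edge_j; left.
- by apply: edge_i; right; left.
- by apply: edge_k; left.
- by apply: edge_k; right; right.
- by apply: edge_j; right; left.
- by apply: edge_i; right; right.
- by apply: edge_l; left.
- by apply: edge_l; right; right.
- by apply: edge_j; right; right.
Qed.

Lemma intrinsic_diam_le_sqrt i j : longest_edge T i j ->
  (intrinsic_diam (surface T) <= (2 / Num.sqrt 3 * edge_length T i j)%:E)%E.
Proof.
move=> ij; set d := edge_length T i j; set K := _ * d.
have d0 : 0 <= d by exact: enorm_ge0.
have K0 : 0 <= K by rewrite mulr_ge0 // divr_ge0 // sqrtr_ge0.
have K2 : K ^+ 2 = 4 / 3 * d ^+ 2.
  by rewrite /K exprMn expr_div_n sqr_sqrtr // -natrX.
have dK : d <= K.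
  by rewrite -ler_sqr ?nnegrE // K2; have := sqr_ge0 d; lra.
have Vd k l : enorm (V k - V l) <= d by exact: longest_edge_le.
apply: (intrinsic_diam_le dK Vd) => a.
have [b [c [e u]]] := face_ex a.
by apply/(vertex_leP _ u)/(vertex_face_le_wide d0 K0 K2).
Qed.

(** From one end of the longest edge: [y] is projected to the side from [V j] to [V k] parallel to
    the short edge, by replacing [V l] with [V k]. With weight c + v away from [V j], the saving (c
    + v) d / 2 outweighs the extra (c + v) e + 2 v e. *)
Lemma thick_vertex_ends i j k l (d e : R) : uniq [:: i; j; k; l] -> 6 * e <= d ->
    enorm (V i - V j) <= d -> enorm (V i - V k) <= d / 2 + e ->
    enorm (V k - V l) <= 2 * e ->
  vertex_le d i.
Proof.
move=> u ed AB AC CD; apply/(vertex_leP _ u) => y.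
move=> [w [c [v [w0 c0 v0 s ->]]]].
exists ((1 - (c + v)) *: V j + (c + v) *: V k); split.
  by left; exists (c + v); split; [lra | lra |].
have -> : V i - ((1 - (c + v)) *: V j + (c + v) *: V k) =
    w *: (V i - V j) + (c + v) *: (V i - V k).
  by rewrite (_ : w = 1 - (c + v)); [rowring | lra].
have -> : (1 - (c + v)) *: V j + (c + v) *: V k - (w *: V j + c *: V k + v *: V l) =
    v *: (V k - V l).
  by rewrite (_ : w = 1 - (c + v)); [rowring | lra].
have h := ler_enormD (w *: (V i - V j)) ((c + v) *: (V i - V k)).
have le_term (a b : R) X : 0 <= a -> enorm X <= b -> enorm (a *: X) <= a * b.
  by move=> a0 Xb; rewrite enormZ ger0_norm // ler_wpM2l.
have h1 := le_term _ _ _ w0 AB.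
have h2 := le_term _ _ _ (addr_ge0 c0 v0) AC.
have h3 := le_term _ _ _ v0 CD.
have cv : 0 <= (c + v) * (d - 6 * e) by apply: mulr_ge0; [exact: addr_ge0 | lra].
have ce : 0 <= c * e.
  rewrite mulr_ge0 //; have := enorm_ge0 (V k - V l); lra.
have ws : w = 1 - (c + v) by lra.
by rewrite ws in h1 h *; lra.
Qed.

(** From a vertex near the midpoint: along the short edge to [V l], then straight to [y], in all at
    most d / 2 + 3 e. *)
Lemma thick_vertex_middle i j k l (d e : R) : uniq [:: k; l; i; j] -> 6 * e <= d ->
    enorm (V i - V l) <= d / 2 + e -> enorm (V j - V l) <= d / 2 + e ->
    enorm (V k - V l) <= 2 * e ->
  vertex_le d k.
Proof.
move=> u ed AD BD CD; apply/(vertex_leP _ u) => y hy.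
exists (V l); split; first by left; exact: seg_l.
have : enorm (y - V l) <= d / 2 + e.
  apply: (tri_dist hy) => //; rewrite subrr enorm0.
  have := enorm_ge0 (V i - V l); lra.
rewrite (enorm_distC y); have := enorm_ge0 (V k - V l); lra.
Qed.

Lemma thick_diam (eps : R) : 0 < eps -> eps < 1 / 6 -> thick eps T ->
  intrinsic_diam (surface T) = extrinsic_diam (surface T).
Proof.
move=> eps0 eps6 [i [j [k [l [ij kl ball]]]]].
set d := edge_length T i j.
have d0 : 0 < d by exact: longest_edge_gt0.
have Vd a b : enorm (V a - V b) <= d by exact: longest_edge_le.
pose e := eps * d.
have e6 : 6 * e < d by rewrite /e; nra.
have e0 : 0 <= e by rewrite mulr_ge0 // ltW.
apply/eqP; rewrite eq_le extrinsic_le_intrinsic andbT (extrinsic_diamE ij).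
have near a : a = k \/ a = l -> enorm (V a - edge_midpoint T i j) <= e.
  move=> akl; have : edge T k l (V a).
    case: akl => ->; [exists 0 | exists 1]; rewrite /= ?in_itv /= ?lexx ?ler01 //.
      by rewrite subr0 scale1r scale0r addr0.
    by rewrite subrr scale1r scale0r add0r.
  by move=> /ball; rewrite /eclosed_ball /= (extrinsic_diamE ij) -EFinM lee_fin.
have half a b : enorm (V a - V b) = d -> enorm (V a - 2^-1 *: (V a + V b)) = d / 2.
  move=> <-; have -> : V a - 2^-1 *: (V a + V b) = 2^-1 *: (V a - V b).
    by apply/rowP => m; rewrite !mxE; field.
  by rewrite enormZ ger0_norm ?invr_ge0 // mulrC.
have Ai : enorm (V i - edge_midpoint T i j) = d / 2 by exact: half.
have Bj : enorm (V j - edge_midpoint T i j) = d / 2.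
  by rewrite /edge_midpoint (addrC (V i)); apply: half; rewrite enorm_distC.
(* The ends of the longest edge are at distance d / 2 > e from its midpoint, so the short edge is
   the opposite one. *)
have far a b : (a = k \/ a = l) -> enorm (V b - edge_midpoint T i j) = d / 2 -> a != b.
  move=> akl bd; apply/eqP => ab; have := near a akl; rewrite ab bd; lra.
have ki := far k i (or_introl erefl) Ai; have kj := far k j (or_introl erefl) Bj.
have li := far l i (or_intror erefl) Ai; have lj := far l j (or_intror erefl) Bj.
have Ck := near k (or_introl erefl); have Dl := near l (or_intror erefl).
have ij' := ij.1.
have dist2 a b r s : enorm (V a - edge_midpoint T i j) <= r ->
    enorm (V b - edge_midpoint T i j) <= s -> enorm (V a - V b) <= r + s.
  move=> ar bs; apply: le_trans (ler_enorm_dist (edge_midpoint T i j) _ _) _.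
  by rewrite lerD // enorm_distC.
have CD : enorm (V k - V l) <= 2 * e by have := dist2 _ _ _ _ Ck Dl; lra.
have DC : enorm (V l - V k) <= 2 * e by rewrite enorm_distC.
have u : uniq [:: i; j; k; l].
  by rewrite /= !inE !negb_or ij' kl !(eq_sym i) !(eq_sym j) ki li kj lj.
have u' : uniq [:: j; i; k; l] by exact: uniq4_swap.
have uk : uniq [:: k; l; i; j] by do 2!apply: uniq4_rot.
have ul : uniq [:: l; k; i; j] by exact: uniq4_swap.
have Ai' : enorm (V i - edge_midpoint T i j) <= d / 2 by rewrite Ai.
have Bj' : enorm (V j - edge_midpoint T i j) <= d / 2 by rewrite Bj.
apply: (intrinsic_diam_le (lexx d) Vd) => a.
have := uniq4_mem a u; rewrite !inE => /or4P[] /eqP->.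
- by apply: (thick_vertex_ends u (ltW e6)) => //; exact: dist2.
- by apply: (thick_vertex_ends u' (ltW e6)) => //; exact: dist2.
- by apply: (thick_vertex_middle uk (ltW e6)) => //; exact: dist2.
- by apply: (thick_vertex_middle ul (ltW e6)) => //; exact: dist2.
Qed.

End Tetra.

(** * The regular tetrahedron *)

Lemma sum_continuous (R : realType) (X : topologicalType) (I : Type) (s : seq I)
    (F : I -> X -> R) :
  (forall i, continuous (F i)) -> continuous (fun x => \sum_(i <- s) F i x).
Proof.
move=> Fc; elim: s => [|i s IHs].
  rewrite (_ : (fun _ => _) = cst 0); first by move=> x; exact: cvg_cst.
  by apply/funext => x; rewrite big_nil.
rewrite (_ : (fun _ => _) = F i \+ (fun x => \sum_(j <- s) F j x)).
  by move=> x; apply: cvgD; [exact: Fc | exact: IHs].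
by apply/funext => x; rewrite big_cons.
Qed.

(** * Barycentric coordinates as continuous functions on space *)

Section Barycentric.
Variable R : realType.
Variable T : tetrahedron R.
Local Notation V := (vertex T).
Local Notation M := (\matrix_(i < 3) (V (lift ord0 i) - V ord0)).
Implicit Types (z : 'rV[R]_3) (k m : 'I_4).

(** An affine formula on the whole space rather than weights chosen on a face, so that continuity
    along curves is available. *)
Definition bary z m : R :=
  if unlift ord0 m is Some j then ((z - V ord0) *m invmx M) 0 j
  else 1 - \sum_j ((z - V ord0) *m invmx M) 0 j.

Lemma bary_comb (w : 'I_4 -> R) m : \sum_i w i = 1 ->
  bary (\sum_i w i *: V i) m = w m.
Proof.
move=> w1; have e : \sum_i w i *: V i - V ord0 = (\row_j w (lift ord0 j)) *m M.
  rewrite mulmx_sum_row -[V ord0 in LHS]scale1r -w1 scaler_suml -sumrB big_ord_recl.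
  rewrite subrr add0r; apply: eq_bigr => j _.
  by rewrite mxE rowK scalerBr.
have uM : M \in unitmx by rewrite -row_free_unit; exact: vertex_row_free.
rewrite /bary e mulmxK //; case: unliftP => [j ->|->]; first by rewrite mxE.
rewrite -w1 big_ord_recl; under [X in _ - X]eq_bigr do rewrite mxE.
by rewrite addrK.
Qed.

Lemma bary_vertex k m : bary (V k) m = (m == k)%:R.
Proof.
rewrite -(@bary_comb (fun m => (m == k)%:R)).
  congr bary; rewrite (bigD1 k) //= eqxx scale1r big1 ?addr0 // => i /negbTE->.
  by rewrite scale0r.
by rewrite (bigD1 k) //= eqxx big1 ?addr0 // => i /negbTE->.
Qed.

Lemma bary_continuous m : continuous (bary^~ m).
Proof.
have lin j : continuous (fun z => ((z - V ord0) *m invmx M) 0 j).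
  have -> : (fun z => ((z - V ord0) *m invmx M) 0 j) =
      (fun z => \sum_k (z 0 k - V ord0 0 k) * invmx M k j).
    by apply/funext => z; rewrite mxE; apply: eq_bigr => k _; rewrite !mxE.
  apply: sum_continuous => k z.
  apply: (@continuous_comp _ _ _ (fun z : 'rV[R]_3 => z 0 k)
    (fun t => (t - V ord0 0 k) * invmx M k j)); first exact: coord_continuous.
  apply: cvgM; last exact: cvg_cst.
  by apply: cvgB; [exact: cvg_id | exact: cvg_cst].
have affine (X : topologicalType) (f : X -> R) : continuous f ->
    continuous (fun x => 1 - f x).
  by move=> fc x; apply: cvgB; [exact: cvg_cst | exact: fc].
rewrite /bary; case: (unlift _ _) => [j|]; first exact: lin.
by apply: affine; exact: sum_continuous.
Qed.

Lemma surface_bary z : surface T z ->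
  [/\ forall m, 0 <= bary z m, \sum_m bary z m = 1, exists k, bary z k = 0 &
      z = \sum_m bary z m *: V m].
Proof.
move=> [k _ [w [w0 w1 wk ->]]]; split.
- by move=> m; rewrite bary_comb.
- by rewrite -[RHS]w1; apply: eq_bigr => m _; rewrite bary_comb.
- by exists k; rewrite bary_comb.
- by apply: eq_bigr => m _; rewrite bary_comb.
Qed.

End Barycentric.

(** The left side is the component along the altitude from A. The squares of the two sides differ by
    d^2 (b - c)^2 / 4. *)
Lemma equilateral_height (R : realType) (A B C : 'rV[R]_3) (d a b c : R) :
    enorm (A - B) = d -> enorm (B - C) = d -> enorm (A - C) = d -> a + b + c = 0 ->
  Num.sqrt 3 / 2 * d * a <= enorm (a *: A + b *: B + c *: C).
Proof.
move=> AB BC AC abc.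
have -> : a *: A + b *: B + c *: C = b *: (B - A) + c *: (C - A).
  by rewrite (_ : a = - b - c); [rowring | lra].
have BB : dot (B - A) (B - A) = d ^+ 2 by rewrite -enorm_sqr enorm_distC AB.
have CC : dot (C - A) (C - A) = d ^+ 2 by rewrite -enorm_sqr enorm_distC AC.
have : dot (B - C) (B - C) = d ^+ 2 by rewrite -enorm_sqr BC.
have -> : B - C = 1 *: (B - A) + (-1) *: (C - A) by rowring.
rewrite dot_lin BB CC => BC2.
have d0 : 0 <= d by rewrite -AB enorm_ge0.
apply: le_trans (ler_norm _) _.
rewrite -ler_sqr ?nnegrE ?enorm_ge0 // real_normK ?num_real // enorm_sqr.
rewrite dot_lin BB CC !exprMn sqr_sqrtr // exprVn.
have -> : a = - (b + c) by lra.
have : 0 <= d ^+ 2 * (b - c) ^+ 2 by rewrite mulr_ge0 ?sqr_ge0.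
have -> : 2 * b * c * dot (B - A) (C - A) = b * c * d ^+ 2.
  by rewrite (_ : dot (B - A) (C - A) = d ^+ 2 / 2); [field | lra].
have -> : 3 * (2 ^+ 2)^-1 * d ^+ 2 * (- (b + c)) ^+ 2 = 3 / 4 * d ^+ 2 * (b + c) ^+ 2 :> R.
  by field.
lra.
Qed.

(** * A Lipschitz potential and the intrinsic diameter *)

Section Regular.
Variable R : realType.
Variable T : tetrahedron R.
Hypothesis Treg : regular T.
Local Notation V := (vertex T).
Implicit Types (z : 'rV[R]_3) (k m : 'I_4).
Let d := edge_length T 0 1.
Let h := Num.sqrt 3 / 2 * d.

Lemma regular_longest : longest_edge T 0 1.
Proof. by split=> // k l kl; rewrite (Treg kl (isT : 0 != 1 :> 'I_4)). Qed.

Lemma regular_height_ge0 : 0 <= h.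
Proof. by rewrite mulr_ge0 ?enorm_ge0 // divr_ge0 // sqrtr_ge0. Qed.

(** On an equilateral face, [h] times the coordinate of [m] is the distance to the side opposite to
    [V m]. *)
Lemma face_height z z' k m : surface T z -> surface T z' ->
  bary T z k = 0 -> bary T z' k = 0 -> m != k ->
  h * (bary T z m - bary T z' m) <= enorm (z - z').
Proof.
move=> Sz Sz' zk z'k; rewrite eq_sym => km; have [b [c u]] := uniq4_ex km.
have [_ w1 _ ez] := surface_bary Sz; have [_ w1' _ ez'] := surface_bary Sz'.
rewrite {2}ez {2}ez' !(sum_uniq4 _ u) zk z'k !scale0r !add0r.
rewrite (sum_uniq4 _ u) zk add0r in w1; rewrite (sum_uniq4 _ u) z'k add0r in w1'.
have -> : bary T z m *: V m + bary T z b *: V b + bary T z c *: V c -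
  (bary T z' m *: V m + bary T z' b *: V b + bary T z' c *: V c) =
  (bary T z m - bary T z' m) *: V m + (bary T z b - bary T z' b) *: V b +
  (bary T z c - bary T z' c) *: V c by rowring.
move: u; rewrite /= !inE !negb_or => /and4P[_ /andP[mb mc] bc _].
by apply: equilateral_height; [exact: Treg | exact: Treg | exact: Treg | lra].
Qed.

Definition min_bary z : R := Num.min (bary T z 1) (Num.min (bary T z 2%:R) (bary T z 3%:R)).

Lemma ord4P m : m != 0 -> m = 1 \/ m = 2%:R \/ m = 3%:R.
Proof.
by case: m => [[|[|[|[|]]]] //] ? _;
  [left|right; left|right; right]; exact/val_inj.
Qed.

Lemma min_bary_le z m : m != 0 -> min_bary z <= bary T z m.
Proof. by move=> /ord4P[->|[->|->]]; rewrite !ge_min lexx ?orbT. Qed.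

Lemma min_bary_ex z : exists2 m, m != 0 & min_bary z = bary T z m.
Proof.
by rewrite /min_bary /Num.min; case: ifP => _; [exists 1|case: ifP => _; [exists 2%:R|exists 3%:R]].
Qed.

(* [h] is the height of a face: this is the distance to the line through [V 0]
   parallel to the opposite side on the faces around [V 0], and [h] plus the
   distance to the boundary on the face opposite to [V 0]. *)
Definition potential z := h * (1 - bary T z 0 + min_bary z).

(** On the face opposite to [V 0] a minimum of three functions is controlled by the one minimal at
    [z']; on the other faces [min_bary] vanishes and only the coordinate of [V 0] varies. *)
Lemma potential_lip z z' k : surface T z -> surface T z' ->
  bary T z k = 0 -> bary T z' k = 0 -> potential z - potential z' <= enorm (z - z').
Proof.
move=> Sz Sz' zk z'k; have h0 := regular_height_ge0.
have [k0|k0] := eqVneq k 0.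
  have [m m0 mz'] := min_bary_ex z'; have mz := min_bary_le z m0.
  rewrite k0 in zk z'k; rewrite /potential zk z'k mz'.
  apply: le_trans (face_height Sz Sz' zk z'k m0).
  by rewrite -mulrBr ler_wpM2l //; lra.
have min0 y : surface T y -> bary T y k = 0 -> min_bary y = 0.
  move=> /surface_bary[y0 _ _ _] yk; apply/eqP; rewrite eq_le -{1}yk min_bary_le //=.
  by have [m _ ->] := min_bary_ex y.
rewrite /potential !min0 // !addr0 enorm_distC.
apply: le_trans (face_height Sz' Sz z'k zk (m := 0) _); last by rewrite eq_sym.
by rewrite -mulrBr ler_wpM2l //; lra.
Qed.

(** The times spent on each face form a closed set, so [piecewise_lipschitz_chain] gives an
    inscribed polygon at least as long as the gain in potential. *)
Lemma regular_path_ge x y g : is_path_on (surface T) x y g ->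
  ((potential y - potential x)%:E <= curve_length g)%E.
Proof.
move=> [gc g0 g1 gS].
have gS' t : 0 <= t -> t <= 1 -> surface T (g t).
  by move=> t0 t1; apply: gS; exists t => //=; rewrite in_itv /= t0.
pose C k := `[0, 1]%classic `&` [set t | bary T (g t) k = 0].
have Cclosed k : closed (C k).
  rewrite closed_setSI; last exact: itv_closed.
  have cont : {within `[0, 1], continuous (fun t => bary T (g t) k)}.
    by move=> t; exact: (continuous_comp (gc t) (@bary_continuous _ T k (g t))).
  exact: (closed_comp (fun t _ => cont t) (@closed_eq _ 0)).
have lip k s t : C k s -> C k t -> potential (g t) - potential (g s) <= enorm (g t - g s).
  rewrite /C /= !in_itv /= => -[/andP[s0 s1] sk] [/andP[t0 t1] tk].
  by apply: potential_lip; [exact: gS' | exact: gS' | exact: tk | exact: sk].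
have cov t : 0 <= t -> t <= 1 -> exists2 k, k \in enum 'I_4 & C k t.
  move=> t0 t1; have [_ _ [k tk] _] := surface_bary (gS' _ t0 t1).
  by exists k; rewrite ?mem_enum //; split=> //=; rewrite in_itv /= t0.
have [s ps hs] := piecewise_lipschitz_chain (h := potential \o g) (enum_uniq _)
  ler01 Cclosed lip cov.
apply: le_trans (chain_length_le_curve_length g ps).
by rewrite lee_fin -g0 -g1.
Qed.

Lemma regular_intrinsic_diam : intrinsic_diam (surface T) = (2 / Num.sqrt 3 * d)%:E.
Proof.
apply/eqP; rewrite eq_le (intrinsic_diam_le_sqrt regular_longest) /=.
(* The weights of the centre [G] of the face opposite to [V 0]. *)
pose w (m : 'I_4) : R := if m == 0 then 0 else 3^-1.
have w1 : \sum_m w m = 1 by rewrite !big_ord_recl big_ord0 /w /=; field.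
pose G := \sum_m w m *: V m.
have SG : surface T G.
  exists 0 => //; exists w; split=> // m; rewrite /w; case: ifP => // _.
apply: (@le_trans _ _ (intrinsic_dist (surface T) (V 0) G)); last first.
  by apply: ereal_sup_ubound; exists (V 0, G) => //; split=> //; exact: vertex_surface.
apply: le_ereal_inf_tmp => _ [g gp <-].
apply: le_trans (regular_path_ge gp).
(* The potential is 0 at [V 0] and h (1 + 1/3) at [G], and 4 h / 3 = 2 d / sqrt 3. *)
rewrite lee_fin /potential /min_bary !bary_comb // !bary_vertex /w /= !minxx.
rewrite subrr add0r mulr0 subr0 subr0 /h.
have s3 : Num.sqrt 3 != 0 :> R by rewrite sqrtr_eq0 -ltNge.
have s33 : (Num.sqrt 3)^-1 = Num.sqrt 3 / 3 :> R.
  by apply: (mulfI s3); rewrite mulfV // mulrA -expr2 sqr_sqrtr // divff.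
rewrite s33; lra.
Qed.

End Regular.

(** * Examples and conclusion *)

Section Examples.
Variable R : realType.

Definition vec3 (a b c : R) : 'rV[R]_3 := \row_j [:: a; b; c]`_j.

Lemma vec3B a b c a' b' c' : vec3 a b c - vec3 a' b' c' = vec3 (a - a') (b - b') (c - c').
Proof. by apply/rowP => [[[|[|[|]]]]] // ?; rewrite !mxE. Qed.

Lemma enorm_vec3 a b c : enorm (vec3 a b c) = Num.sqrt (a ^+ 2 + b ^+ 2 + c ^+ 2).
Proof. by rewrite /enorm !big_ord_recl big_ord0 !mxE /= addr0 addrA. Qed.

(** Alternate vertices of the unit cube; the edges are face diagonals of length sqrt 2. *)
Definition regular_vertex (i : 'I_4) : 'rV[R]_3 :=
  nth 0 [:: vec3 0 0 0; vec3 1 1 0; vec3 1 0 1; vec3 0 1 1] i.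

(** The longest edge has length 2 and midpoint 0, and the opposite edge lies within 1/10 of 0,
    inside the radius 1/5 allowed for thickness 1/10 < 1/6. *)
Definition thick_vertex (i : 'I_4) : 'rV[R]_3 :=
  nth 0 [:: vec3 (-1) 0 0; vec3 1 0 0; vec3 0 10^-1 0; vec3 0 0 10^-1] i.

Lemma ord3P (i : 'I_3) :
  i = ord0 \/ i = lift ord0 ord0 \/ i = lift ord0 (lift ord0 ord0).
Proof.
by case: i => [[|[|[|]]]] // ?; [left|right; left|right; right]; exact/val_inj.
Qed.

Lemma regular_row_free :
  row_free (\matrix_(i < 3) (regular_vertex (lift ord0 i) - regular_vertex ord0)).
Proof.
apply: inj_row_free => v /rowP v0.
have := v0 ord0; have := v0 (lift ord0 ord0); have := v0 (lift ord0 (lift ord0 ord0)).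
rewrite !mxE !big_ord_recl !big_ord0 !mxE /= => e2 e1 e0.
by apply/rowP => i; rewrite mxE; have [->|[->|->]] := ord3P i; lra.
Qed.

Lemma thick_row_free :
  row_free (\matrix_(i < 3) (thick_vertex (lift ord0 i) - thick_vertex ord0)).
Proof.
apply: inj_row_free => v /rowP v0.
have := v0 ord0; have := v0 (lift ord0 ord0); have := v0 (lift ord0 (lift ord0 ord0)).
rewrite !mxE !big_ord_recl !big_ord0 !mxE /= => e2 e1 e0.
by apply/rowP => i; rewrite mxE; have [->|[->|->]] := ord3P i; lra.
Qed.

Definition regular_example := Tetrahedron regular_row_free.
Definition thick_example := Tetrahedron thick_row_free.

Lemma regular_exampleP : regular regular_example.
Proof.
have len i j : i != j -> edge_length regular_example i j = Num.sqrt 2.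
  move=> ij; rewrite /edge_length /= /regular_vertex.
  move: i j ij => [[|[|[|[|]]]] //= ?] [[|[|[|[|]]]] //= ?] _;
    rewrite vec3B enorm_vec3; congr Num.sqrt; ring.
by move=> i j k l ij kl; rewrite !len.
Qed.

Lemma thick_example_longest : longest_edge thick_example 0 1.
Proof.
split=> // i j _; rewrite /edge_length /= /thick_vertex.
move: i j => [[|[|[|[|]]]] //= ?] [[|[|[|[|]]]] //= ?];
  rewrite !vec3B !enorm_vec3 ler_wsqrtr //; lra.
Qed.

Lemma thick_exampleP : thick (10^-1) thick_example.
Proof.
exists 0, 1, 2%:R, 3%:R; split=> //; first exact: thick_example_longest.
move=> _ [t t01 <-]; move: t01; rewrite /= in_itv /= => /andP[t0 t1].
rewrite /eclosed_ball /= (extrinsic_diamE thick_example_longest) -EFinM lee_fin.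
rewrite /edge_length /edge_midpoint /= /thick_vertex /= vec3B !enorm_vec3.
have -> : (1 - t) *: vec3 0 10^-1 0 + t *: vec3 0 0 10^-1 -
    2^-1 *: (vec3 (-1) 0 0 + vec3 1 0 0) = vec3 0 ((1 - t) / 10) (t / 10).
  by apply/rowP => i; rewrite !mxE; have [->|[->|->]] := ord3P i; rewrite /=; field.
rewrite enorm_vec3 (_ : (-1 - 1) ^+ 2 + _ + _ = 2 ^+ 2 :> R); last by ring.
rewrite sqrtr_sqr ger0_norm // -ler_sqr ?nnegrE ?sqrtr_ge0 //.
by rewrite sqr_sqrtr; nra.
Qed.

End Examples.

(** * Bounds and extremal values of the diameter ratio *)

Section Ratio.
Variable R : realType.
Implicit Type T : tetrahedron R.

Lemma diam_ratioE T i j (r : R) : longest_edge T i j ->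
  intrinsic_diam (surface T) = r%:E -> diam_ratio (surface T) = (r / edge_length T i j)%:E.
Proof.
move=> ij r_diam; rewrite /diam_ratio (extrinsic_diamE ij) r_diam inver.
by rewrite gt_eqF ?longest_edge_gt0 // EFinM.
Qed.

Lemma diam_ratio_bounds T :
  (1 <= diam_ratio (surface T))%E /\
  (diam_ratio (surface T) <= (2 / Num.sqrt 3)%:E)%E.
Proof.
have [i [j ij]] := longest_edge_ex T; have d0 := longest_edge_gt0 ij.
have lo := extrinsic_le_intrinsic T; have hi := intrinsic_diam_le_sqrt ij.
rewrite (extrinsic_diamE ij) in lo.
(* The two real bounds exclude infinite values, so the division is one of real numbers. *)
case e : (intrinsic_diam (surface T)) lo hi => [r| |] //; rewrite !lee_fin => lo hi.
rewrite (diam_ratioE ij e) !lee_fin; split; last by rewrite ler_pdivrMr.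
by rewrite ler_pdivlMr // mul1r.
Qed.

Lemma regular_diam_ratio T : regular T -> diam_ratio (surface T) = (2 / Num.sqrt 3)%:E.
Proof.
move=> Treg; have d0 := longest_edge_gt0 (regular_longest Treg).
rewrite (diam_ratioE (regular_longest Treg) (regular_intrinsic_diam Treg)).
by rewrite mulfK // gt_eqF.
Qed.

Lemma thick_diam_ratio T (eps : R) : 0 < eps -> eps < 1 / 6 -> thick eps T ->
  diam_ratio (surface T) = 1%E.
Proof.
move=> eps0 eps6 /(thick_diam eps0 eps6) e.
have [i [j ij]] := longest_edge_ex T; rewrite (extrinsic_diamE ij) in e.
by rewrite (diam_ratioE ij e) divff // gt_eqF // longest_edge_gt0.
Qed.

End Ratio.

Unset Implicit Arguments.

Theorem theorem1 (R : realType) :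
  (forall T : tetrahedron R,
     (1 <= diam_ratio (surface T))%E /\
     (diam_ratio (surface T) <= (2 / Num.sqrt 3)%:E)%E) /\
  (exists T : tetrahedron R, diam_ratio (surface T) = 1%E) /\
  (exists T : tetrahedron R, diam_ratio (surface T) = (2 / Num.sqrt 3)%:E) /\
  (exists eps0 : R, 0 < eps0 /\
     forall (eps : R) (T : tetrahedron R), 0 < eps -> eps < eps0 ->
       thick eps T ->
       intrinsic_diam (surface T) = extrinsic_diam (surface T)) /\
  (forall T : tetrahedron R, regular T ->
     diam_ratio (surface T) = (2 / Num.sqrt 3)%:E).
Proof.
split; first exact: diam_ratio_bounds.
split.
  exists (thick_example R); apply: thick_diam_ratio (thick_exampleP R); lra.
split; first by exists (regular_example R); exact/regular_diam_ratio/regular_exampleP.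
split; last exact: regular_diam_ratio.
exists (1 / 6); split; first by lra.
by move=> eps T; exact: thick_diam.
Qed.
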